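(* Let $(\mathcal{G}_{n})_{n}$ be a family in which, for each $n$, $\mathcal{G}_n$ is the orbit graph, constructed with the parabolic generators, of an $\mathrm{SL}(2,\mathbb{Z})$-orbit of primitive $n$-squared origamis, all in $\mathcal{H}(2)$, or all in the Prym locus of $\mathcal{H}(4)$, or all in the Prym locus of $\mathcal{H}(6)$. Then the number of faces of length at most four in $\mathcal{G}_{n}$ is $o(|\mathcal{G}_{n}|)$ as $n\to\infty$.
   Context: An origami is a translation surface $(M,\pi^{*}(dz))$ where $M$ is a connected compact Riemann surface and $\pi:M\to\mathbb{T}^2=\mathbb{C}/(\mathbb{Z}\oplus i\mathbb{Z})$ is a finite cover possibly branched only over $0$; it is $n$-squared if $\deg\pi=n$. Equivalently it is a pair $(h,v)\in \mathrm{Sym}(n)^2$ generating a transitive subgroup, up to simultaneous conjugation: take unit squares $sq(1),\dots,sq(n)$, glue the right side of $sq(i)$ to the left side of $sq(h(i))$ and the top of $sq(i)$ to the bottom of $sq(v(i))$. An origami is primitive if it is not a cover of another origami different from itself or the unit-square torus (equivalently, $\langle h,v\rangle$ is a primitive permutation group). $\mathcal{H}(k_1,\dots,k_s)$ is the moduli space (stratum) of translation surfaces $(M,\omega)$ where $\omega$ has zeros of orders $k_1,\dots,k_s$, $\sum k_j=2g-2$. $\mathrm{SL}(2,\mathbb{Z})$ acts on primitive $n$-squared origamis in a stratum (restricting the natural $\mathrm{SL}(2,\mathbb{R})$-action), with $T=\begin{bmatrix}1&1\\0&1\end{bmatrix}$, $S=\begin{bmatrix}1&0\\1&1\end{bmatrix}$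 acting by $T(h,v)=(h,vh^{-1})$, $S(h,v)=(hv^{-1},v)$. Prym loci: for a discriminant $D>0$, $\mathcal{O}_D$ denotes the real quadratic order of discriminant $D$. The Prym locus of $\mathcal{H}(4)$ (resp. $\mathcal{H}(6)$) consists of those $(M,\omega)$ in the stratum for which $M$ admits a holomorphic involution $\iota$ with exactly $4$ (resp. $2$) fixed points with $\iota^*\omega=-\omega$, and whose Prym variety admits real multiplication by $\mathcal{O}_D$ for some $D$, with $\mathcal{O}_D\cdot\omega\subset\mathbb{C}\cdot\omega$. Orbit graphs: the parabolic generators are $T,S$. The orbit graph has the elements of the orbit as vertices and, for each vertex $X$, one edge joining $X$ to $T(X)$ and one edge joining $X$ to $S(X)$, considered as an undirected graph (loops and multiple edges allowed); it is $4$-regular. $|\mathcal{G}|$ is the number of vertices. Faces of $\mathcal{G}$ are the faces of an embedding of $\mathcal{G}$ in a closed orientable surface of minimal genus; the length of a face is the number of edges in its boundary walk, counted with multiplicity. *)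

(* Defs.v *)
From HB Require Import structures.
From mathcomp Require Import all_boot all_order all_algebra.
From mathcomp Require Import all_fingroup all_solvable.
From mathcomp Require Import complex.
From mathcomp Require Import all_classical all_reals all_analysis.
From Stdlib Require Import Relations.

Set Implicit Arguments.
Unset Strict Implicit.
Unset Printing Implicit Defensive.

Import Order.TTheory GRing.Theory Num.Theory.
Import numFieldNormedType.Exports.

(* A pair (h, v): the right side of square i is glued to the left side of
   square h i, its top to the bottom of square v i. *)
Definition sqpair (n : nat) : Type := ('S_n * 'S_n)%type.

(* An n-squared origami is a pair up to simultaneous conjugation; it is
   represented by its conjugation class, a set of pairs. *)
Definition iso_class n (o : sqpair n) : {set sqpair n} :=
  [set ((o.1 ^ s)%g, (o.2 ^ s)%g) | s : 'S_n].

(* Connectedness of the surface is the transitivity part of primitivity. *)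
Definition primitive_origami n (o : sqpair n) : bool :=
  [primitive <<[set o.1; o.2]>>%g, on [set: 'I_n] | 'P].

(* Vertices of the squares correspond to the cycles of the commutator; a cycle
   of length k + 1 is a point of cone angle 2 pi (k + 1), i.e. a zero of order k
   of dz.  Vertices with k = 0 are not zeros and are discarded. *)
Definition zero_orders n (o : sqpair n) : seq nat :=
  [seq k <- [seq #|C|.-1 | C : {set 'I_n} <- enum (porbits [~ o.1, o.2]%g)] | (0 < k)%N].

Definition in_stratum (ks : seq nat) n (o : sqpair n) : bool :=
  perm_eq (zero_orders o) ks.

(* The order of the products does not matter: (h, v h^-1) and (h, h^-1 v) are
   simultaneously conjugate. *)
Definition actT n (o : sqpair n) : sqpair n := (o.1, (o.2 * o.1^-1)%g).
Definition actS n (o : sqpair n) : sqpair n := ((o.1 * o.2^-1)%g, o.2).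

Lemma actT_inj n : injective (@actT n).
Proof. by move=> [h v] [h' v'] [-> /mulIg ->]. Qed.

Lemma actS_inj n : injective (@actS n).
Proof. by move=> [h v] [h' v'] /= [] /[swap] -> /mulIg ->. Qed.

Definition permT n : {perm sqpair n} := perm (@actT_inj n).
Definition permS n : {perm sqpair n} := perm (@actS_inj n).

(* T and S generate SL(2, Z), so its orbits are those of the group they
   generate, acting on conjugation classes by direct image. *)
Definition SL2Z_group n : {group {perm sqpair n}} := <<[set permT n; permS n]>>%G.

Definition SL2Z_orbit n (o : sqpair n) : {set {set sqpair n}} :=
  orbit ('P^*)%act (SL2Z_group n) (iso_class o).

Definition gen n (b : bool) : {perm sqpair n} := if b then permT n else permS n.

Lemma gen_orbit n (o : sqpair n) b (X : {set sqpair n}) :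
  X \in SL2Z_orbit o -> (gen n b @: X) \in SL2Z_orbit o.
Proof.
move=> HX; apply: (orbit_trans _ HX).
have -> : gen n b @: X = ('P^*)%act X (gen n b) by [].
by apply: mem_orbit; apply: mem_gen; rewrite /gen !inE; case: b; rewrite eqxx ?orbT.
Qed.

(* Undirected multigraphs, loops allowed; which end of an edge is called the
   source is immaterial. *)
Record multigraph := Multigraph {
  vert : finType;
  edge : finType;
  src : edge -> vert;
  dst : edge -> vert }.

Definition orbit_graph n (o : sqpair n) : multigraph :=
  @Multigraph {X : {set sqpair n} | X \in SL2Z_orbit o}
    ({X : {set sqpair n} | X \in SL2Z_orbit o} * bool)%type
    (fun e => e.1)
    (fun e => exist _ (gen n e.2 @: val e.1) (gen_orbit e.2 (valP e.1))).

(* A dart is an edge with an orientation; it is attached to its tail. *)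
Definition dart (G : multigraph) : finType := (edge G * bool)%type.

Definition tail (G : multigraph) (d : dart G) : vert G :=
  if d.2 then dst d.1 else src d.1.

Definition dart_rev (G : multigraph) (d : dart G) : dart G := (d.1, ~~ d.2).

Lemma dart_rev_inj (G : multigraph) : injective (@dart_rev G).
Proof. by move=> [e b] [e' b'] [-> /negb_inj ->]. Qed.

(* A rotation system: a cyclic order of the darts at each vertex.  These encode
   the cellular embeddings in closed oriented surfaces of a graph without
   isolated vertices.  For a connected graph, every embedding of minimal genus
   is cellular. *)
Definition rotation_system (G : multigraph) (rho : {perm dart G}) : Prop :=
  forall d d' : dart G, (d' \in porbit rho d) = (tail d' == tail d).

Definition face_perm (G : multigraph) (rho : {perm dart G}) : {perm dart G} :=
  (perm (@dart_rev_inj G) * rho)%g.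

(* The length of a face is the cardinal of the corresponding cycle: an edge
   traversed twice contributes two darts. *)
Definition faces (G : multigraph) (rho : {perm dart G}) : {set {set dart G}} :=
  porbits (face_perm rho).

(* From Euler's formula V - E + F = 2 - 2g for a connected graph. *)
Definition genus (G : multigraph) (rho : {perm dart G}) : nat :=
  ((2 + #|edge G| - (#|vert G| + #|faces rho|))./2)%N.

Definition min_genus_embedding (G : multigraph) (rho : {perm dart G}) : Prop :=
  rotation_system rho /\
  forall rho' : {perm dart G}, rotation_system rho' -> (genus rho <= genus rho')%N.

Definition short_faces (G : multigraph) (rho : {perm dart G}) : {set {set dart G}} :=
  [set f in faces rho | (#|f| <= 4)%N].

Local Open Scope classical_set_scope.
Local Open Scope ring_scope.
Local Open Scope complex_scope.

Section Surface.

Variables (R : realType) (n : nat) (o : sqpair n).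

Local Notation C := (R[i]^o).
Let h : 'S_n := o.1.
Let v : 'S_n := o.2.

(* (i, z) is the point z of the closed unit square number i. *)
Definition pt : Type := ('I_n * C)%type.

Definition in_square (z : C) : Prop :=
  0 <= complex.Re z <= 1 /\ 0 <= complex.Im z <= 1.

Definition in_open_square (z : C) : Prop :=
  0 < complex.Re z < 1 /\ 0 < complex.Im z < 1.

Definition is_corner (z : C) : Prop :=
  (complex.Re z = 0 \/ complex.Re z = 1) /\ (complex.Im z = 0 \/ complex.Im z = 1).

Inductive glued : pt -> pt -> Prop :=
| glued_h (i : 'I_n) (y : R) : 0 <= y <= 1 -> glued (i, 1 +i* y) (h i, 0 +i* y)
| glued_v (i : 'I_n) (x : R) : 0 <= x <= 1 -> glued (i, x +i* 1) (v i, x +i* 0).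

(* The surface M is the set of (i, z) with in_square z, modulo same_point. *)
Definition same_point : pt -> pt -> Prop := clos_refl_sym_trans pt glued.

Definition surface_open (U : set pt) : Prop :=
  (forall p q, same_point p q -> (U p <-> U q)) /\
  forall i, exists W : set C, open W /\ forall z, in_square z -> (U (i, z) <-> W z).

(* Translation chart: for z close to a point z0 of the closed square that is not
   a corner, the point of M reached from (i, z0) by the displacement z - z0,
   represented in [0, 1) x [0, 1). *)
Definition chart_h (p : pt) : pt :=
  let: (i, z) := p in
  if complex.Re z < 0 then ((h^-1)%g i, z + 1)
  else if complex.Re z < 1 then (i, z) else (h i, z - 1).

Definition chart_v (p : pt) : pt :=
  let: (i, z) := p in
  if complex.Im z < 0 then ((v^-1)%g i, z + (0 +i* 1))
  else if complex.Im z < 1 then (i, z) else (v i, z - (0 +i* 1)).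

Definition chart (p : pt) : pt := chart_v (chart_h p).

(* f represents the one-form f dz on M.  Only the values of f on
   [0, 1) x [0, 1) minus the corner matter.  At a zero of order k of dz a
   uniformizer w satisfies w^(k+1) = z - c, so f dz extends holomorphically iff
   w^k f is bounded near w = 0, iff (z - c) f tends to 0. *)
Definition holomorphic_form (f : pt -> C) : Prop :=
  (forall i z, in_square z -> ~ is_corner z ->
     derivable (fun w : C => f (chart (i, w))) z 1) /\
  (forall i c, in_square c -> is_corner c ->
     (fun z : C => (z - c) * f (i, z)) @ within in_open_square (nbhs c) --> (0 : C)).

(* (a, b) is the integral one-chain sum_i a_i r_i + b_i u_i, where r_i is the
   horizontal path from the centre of square i to that of square h i, and u_i
   the vertical path from the centre of square i to that of square v i.  Every
   class in H_1(M, Z) contains such a cycle. *)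
Definition chain : Type := ({ffun 'I_n -> int} * {ffun 'I_n -> int})%type.

Definition is_cycle (c : chain) : Prop :=
  forall i, c.1 i + c.2 i = c.1 ((h^-1)%g i) + c.2 ((v^-1)%g i).

(* The algebraic intersection number: moving every square centre to the lower
   left corner pushes r_j to the bottom side of square j and u_j to its left
   side; r_i crosses the left side of square h i with sign +1, and u_i crosses
   the bottom side of square v i with sign -1. *)
Definition intersection (c d : chain) : int :=
  \sum_i (c.1 i * d.2 (h i) - c.2 i * d.1 (v i)).

Definition cintegral (a b : R) (g : R -> C) : C :=
  (\int[lebesgue_measure]_(x in `[a, b]) complex.Re (g x)) +i*
  (\int[lebesgue_measure]_(x in `[a, b]) complex.Im (g x)).

Definition period_r (f : pt -> C) (i : 'I_n) : C :=
  cintegral (1 / 2) 1 (fun x => f (i, x +i* (1 / 2))) +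
  cintegral 0 (1 / 2) (fun x => f (h i, x +i* (1 / 2))).

Definition period_u (f : pt -> C) (i : 'I_n) : C :=
  (0 +i* 1) * (cintegral (1 / 2) 1 (fun y => f (i, (1 / 2) +i* y)) +
                cintegral 0 (1 / 2) (fun y => f (v i, (1 / 2) +i* y))).

Definition period (c : chain) (f : pt -> C) : C :=
  \sum_i (period_r f i *~ c.1 i + period_u f i *~ c.2 i).

(* A holomorphic involution iota of M with iota^* dz = - dz, given on
   representatives of points.  Away from a finite set it is z |-> - z + const
   in translation charts; being continuous, it is then holomorphic on M. *)
Definition anti_involution (iota : pt -> pt) : Prop :=
  [/\ forall p, in_square p.2 -> in_square (iota p).2,
      forall p q, in_square p.2 -> in_square q.2 ->
        same_point p q -> same_point (iota p) (iota q),
      forall p, in_square p.2 -> same_point (iota (iota p)) p,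
      forall U, surface_open U ->
        exists2 V, surface_open V & forall p, in_square p.2 -> (V p <-> U (iota p)) &
      forall p, in_square p.2 -> ~ is_corner p.2 -> ~ is_corner (iota p).2 ->
        \forall u \near (0 : C),
          same_point (iota (chart (p.1, p.2 + u)))
                     (chart ((iota p).1, (iota p).2 - u))].

Definition fixed_points_count (iota : pt -> pt) (k : nat) : Prop :=
  exists q : 'I_k -> pt,
    [/\ forall a, in_square (q a).2 /\ same_point (iota (q a)) (q a),
        forall a b, same_point (q a) (q b) -> a = b &
        forall p, in_square p.2 -> same_point (iota p) p ->
          exists a, same_point p (q a)].

(* g dz = iota^* (f dz). *)
Definition is_pullback (iota : pt -> pt) (f g : pt -> C) : Prop :=
  forall p, in_square p.2 -> ~ is_corner p.2 -> ~ is_corner (iota p).2 ->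
    g (chart p) = - f (chart (iota p)).

(* Omega(M)^-, the one-forms eta with iota^* eta = - eta. *)
Definition Prym_form (iota : pt -> pt) (f : pt -> C) : Prop :=
  holomorphic_form f /\ is_pullback iota f (fun p => - f p).

(* H_1(M, Z)^-, the classes gamma with iota_* gamma = - gamma.  H_1(M, Z) embeds
   in the dual of Omega(M) by periods. *)
Definition Prym_cycle (iota : pt -> pt) (c : chain) : Prop :=
  is_cycle c /\
  forall f g, holomorphic_form f -> holomorphic_form g -> is_pullback iota f g ->
    period c g = - period c f.

(* Equality of the classes of c and d in the lattice H_1(M, Z)^- of
   (Omega(M)^-)^*. *)
Definition Prym_eq (iota : pt -> pt) (c d : chain) : Prop :=
  forall f, Prym_form iota f -> period c f = period d f.

(* Endomorphisms of Prym(M, iota) = (Omega(M)^-)^* / H_1(M, Z)^- : maps of the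
   lattice whose transpose preserves Omega(M)^- ; the latter condition implies
   additivity and says that the real-linear extension is complex-linear. *)
Definition Prym_endo (iota : pt -> pt) (A : chain -> chain) : Prop :=
  (forall c, Prym_cycle iota c -> Prym_cycle iota (A c)) /\
  (forall f, Prym_form iota f -> exists2 g, Prym_form iota g &
     forall c, Prym_cycle iota c -> period (A c) f = period c g).

(* The Prym variety has real multiplication by the quadratic order O_D, and
   O_D . omega is contained in C . omega for omega = dz.  Here O_D = Z[t] with
   t^2 + b t + c = 0, b^2 - 4 c = D, and A is the action of t: the subring Z[A]
   of End(Prym) is isomorphic to O_D, consists of endomorphisms self-adjoint for
   the intersection form, and is indivisible, i.e. m U in Z[A] with m <> 0 only
   for U in Z[A].  D is allowed to be a square. *)
Definition real_mult_eigenform (iota : pt -> pt) (D : int) : Prop :=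
  exists (A : chain -> chain) (b c : int),
    [/\ b ^+ 2 - 4 * c = D /\ Prym_endo iota A,
        forall g, Prym_cycle iota g -> Prym_eq iota (A (A g) + A g *~ b + g *~ c) 0,
        forall k l : int,
          (forall g, Prym_cycle iota g -> Prym_eq iota (g *~ k + A g *~ l) 0) ->
          k = 0 /\ l = 0,
        (forall g d, Prym_cycle iota g -> Prym_cycle iota d ->
          intersection (A g) d = intersection g (A d)) /\
        (forall (U : chain -> chain) (m k l : int), Prym_endo iota U -> m != 0 ->
          (forall g, Prym_cycle iota g -> Prym_eq iota (U g *~ m) (g *~ k + A g *~ l)) ->
          exists k' l' : int, forall g, Prym_cycle iota g ->
            Prym_eq iota (U g) (g *~ k' + A g *~ l')) &
        exists lambda : C, forall g, Prym_cycle iota g ->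
          period (A g) (fun=> 1) = lambda * period g (fun=> 1)].

Definition Prym_locus (ks : seq nat) (k : nat) : Prop :=
  in_stratum ks o /\
  exists iota, [/\ anti_involution iota, fixed_points_count iota k &
    exists2 D : int, 0 < D & real_mult_eigenform iota D].

End Surface.

(* Main.v *)
Require Import Defs.
From mathcomp Require Import boolp reals.
From mathcomp Require Import all_boot all_order all_algebra.
From mathcomp Require Import all_fingroup all_solvable all_field.
From mathcomp Require Import ring lra zify.

Set Implicit Arguments.
Unset Strict Implicit.
Unset Printing Implicit Defensive.

Import Order.TTheory GRing.Theory Num.Theory.
Local Open Scope ring_scope.

(** Why the theorem is true.

    The boundary of a face with at most four edges is a closed walk that never
    turns back along the edge it has just followed, so reading its labels gives a
    nontrivial cyclically reduced word w of length at most four in T and S that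
    fixes the vertex where the walk starts.  There are finitely many such words,
    hence it is enough to show that each of them fixes only o(|G|) vertices
    ([card_short_faces]).

    Put a = T and b = S^-1; they satisfy the braid relation aba = bab
    ([braid_TS]).  The conjugates of w by the first m powers of b have equally many
    fixed points.  A common fixed point of two of them is moved by a power of b to a
    fixed point of w^-1 w^(b^d) with 0 < d < m.  Up to rotation, inversion and the
    exchange of a and b, this element is, for most of the words w, a product of
    a^-1's and b's in which both occur: a positive word, of hyperbolic matrix.
    Since no origami with many squares is fixed by such a word (next paragraph), the
    m sets of fixed points are disjoint and w fixes at most |G|/m vertices
    ([fixed_in_thin], [thin_short_word]).  The other words are positive themselves,
    and fix nothing.

    It remains to bound n when a primitive origami o with n squares, with a
    single zero of order at most 6, is fixed by a positive word with hyperbolic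
    matrix M ([no_fixed_origami]).  The word induces an affine homeomorphism of
    the surface, hence an operator Phi on cochains of the graph of squares.  It
    preserves the space of cocycles at the nonsingular vertices and the space W of
    coboundaries, and the quotient has bounded dimension d.  The two sums of a
    cochain over horizontal and over vertical edges are transformed by M, and so
    are the constant cochains.

    Primitivity gives an integral cocycle f with sums e = (0, 1)
    ([exists_unit_cochain]): any two squares are joined by a path of holonomy zero,
    because the commutator subgroup of the monodromy group is transitive.
    Subtracting from n f the constant cochain e gives a cocycle f0 with both sums
    equal to zero.  Let Q be its minimal polynomial modulo W.  It is monic of degree
    at most d, it has integral coefficients as a divisor of the characteristic
    polynomial of Phi, and they are bounded because the eigenvalues of Phi are
    ([bounded_integral_annihilator]).  From f0 Q(Phi) in W one gets that the
    constant cochain e Q(M) is a coboundary modulo n; the potential is constant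
    modulo n by transitivity of the commutator subgroup again
    ([potential_integral]), so n divides e Q(M), a vector bounded in terms of the
    word alone.

    So n is bounded unless e Q(M) = 0.  In that case the characteristic polynomial
    of M divides Q, and the dominant eigenvalue of M also occurs on cocycles with
    sums zero.  A Perron-Frobenius argument excludes this ([perron]): Phi has
    nonnegative entries and a positive constant eigenvector y, and at an eigenvector
    f for the same eigenvalue, the set of edges where f/y is maximal is stable
    under the monodromy, so that f is a multiple of y. *)

(** * Integral annihilators with bounded coefficients *)

Lemma coef_prod_XsubC_le (F : numFieldType) (L : F) (s : seq F) :
  0 <= L -> (forall z, z \in s -> `|z| <= L) ->
  forall k, `|(\prod_(z <- s) ('X - z%:P))`_k| <= (1 + L) ^+ size s.
Proof.
move=> L0; elim: s => [|z s IHs] zL k.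
  by rewrite big_nil expr0 coef1; case: (k == 0)%N; rewrite ?normr1 ?normr0 ?ler01.
have {}IHs j := IHs (fun y ys => zL y (mem_behead (s := z :: s) ys)) j.
rewrite big_cons mulrBl coefB coefXM coefCM exprS mulrDl mul1r.
apply: le_trans (ler_normB _ _) (lerD _ _).
  by case: k => [|k] //=; rewrite normr0 exprn_ge0 // addr_ge0.
by rewrite normrM ler_pM // zL ?mem_head.
Qed.

(** The l1 norm is used for row vectors because it is stable under the moves of
    cochains below: each of them repeats every entry at most twice. *)
Lemma root_char_poly_le (N : nat) (A : 'M[algC]_N.+1) (L : algC) :
  (forall x : 'rV_N.+1, \sum_j `|(x *m A) 0 j| <= L * \sum_j `|x 0 j|) ->
  forall z, root (char_poly A) z -> `|z| <= L.
Proof.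
move=> AL z; rewrite -eigenvalue_root_char => /eigenvalueP[x xA x0].
have x_gt0 : 0 < \sum_j `|x 0 j|.
  rewrite lt_def sumr_ge0 // andbT; apply: contra x0 => /eqP /psumr_eq0P xj0.
  by apply/eqP/rowP=> j; rewrite mxE; apply/normr0_eq0/xj0.
rewrite -(ler_pM2r x_gt0); apply: le_trans (AL x).
by rewrite mulr_sumr le_eqVlt; apply/orP/or_introl/eqP/eq_bigr=> j _; rewrite xA mxE normrM.
Qed.

Lemma stablemx_horner (F : fieldType) (N k : nat) (A : 'M[F]_N.+1) (W : 'M_(k, N.+1)) p :
  stablemx W A -> stablemx W (horner_mx A p).
Proof.
move=> WA; elim/poly_ind: p => [|p c IHp]; first by rewrite rmorph0 mulmx0 sub0mx.
rewrite rmorphD rmorphM /= horner_mx_X horner_mx_C mulmxDr addmx_sub //.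
  by rewrite mulmxA (submx_trans (submxMr _ IHp)).
by rewrite mul_mx_scalar scalemx_sub.
Qed.

(** The iterates of f under A lie in Z, whose image modulo W has dimension at most
    d, so d + 1 of them are dependent modulo W. *)
Lemma exists_annihilator (F : fieldType) (N d k1 k2 : nat) (A : 'M[F]_N.+1) (f : 'rV_N.+1)
    (W : 'M_(k1, N.+1)) (Z : 'M_(k2, N.+1)) :
  (W <= Z)%MS -> stablemx Z A -> (f <= Z)%MS -> (\rank Z <= \rank W + d)%N ->
  exists p : {poly F}, [/\ p != 0, (size p <= d.+1)%N & (f *m horner_mx A p <= W)%MS].
Proof.
move=> WZ ZA fZ rZ.
pose K : 'M_(d.+1, N.+1) := \matrix_i (f *m A ^+ i).
have KZ : (K <= Z)%MS.
  apply/row_subP=> i; rewrite rowK (submx_trans (submxMr _ fZ)) //.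
  by have := stablemx_horner 'X^i ZA; rewrite rmorphXn /= horner_mx_X.
have rK : (\rank (K *m cokermx W) <= d)%N.
  rewrite (leq_trans (mxrankS (submxMr _ KZ))) //.
  have := mxrank_mul_ker Z (cokermx W).
  suff -> : \rank (Z :&: kermx (cokermx W))%MS = \rank W.
    by move=> rE; rewrite -(leq_add2l (\rank W)) addnC rE.
  apply/eqmx_rank/andP; split; last first.
    by rewrite sub_capmx WZ; apply/sub_kermxP; rewrite mulmx_coker.
  by rewrite submxE -sub_kermx capmxSr.
have : kermx (K *m cokermx W) != 0.
  by rewrite kermx_eq0 /row_free neq_ltn ltnS rK.
case/rowV0Pn=> c /sub_kermxP cK c0.
exists (rVpoly c); split.
- by apply: contra c0 => /eqP cE; rewrite -(rVpolyK c) cE linear0.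
- exact: size_poly.
rewrite submxE.
suff -> : f *m horner_mx A (rVpoly c) = c *m K by rewrite -mulmxA cK.
rewrite [RHS]mulmx_sum_row /rVpoly poly_def rmorph_sum mulmx_sumr /=; apply: eq_bigr => i _.
rewrite -mul_polyC rmorphM /= horner_mx_C rmorphXn /= horner_mx_X rowK insubT // => lti.
by rewrite -[_ * _]/(_ *m _) mul_scalar_mx -scalemxAr; congr (c 0 _ *: _); apply: val_inj.
Qed.

Local Notation pZtoQ := (map_poly (intr : int -> rat)).
Local Notation toQ := (map_mx (intr : int -> rat)).

(** Q is the minimal polynomial of f modulo W.  Gauss's lemma makes it integral,
    since it divides the monic integral polynomial char_poly A; its coefficients
    are symmetric functions of at most d eigenvalues of A. *)
Lemma bounded_integral_annihilator (N d k1 k2 L : nat) (A : 'M[int]_N.+1) (f : 'rV[int]_N.+1)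
    (W : 'M[rat]_(k1, N.+1)) (Z : 'M[rat]_(k2, N.+1)) :
  (W <= Z)%MS -> stablemx W (toQ A) -> stablemx Z (toQ A) -> (toQ f <= Z)%MS ->
  (\rank Z <= \rank W + d)%N ->
  (forall x : 'rV[algC]_N.+1,
     \sum_j `|(x *m map_mx intr A) 0 j| <= L%:R * \sum_j `|x 0 j|) ->
  exists Q : {poly int}, [/\ Q \is monic, (size Q <= d.+1)%N,
    forall k, `|Q`_k| <= (1 + L%:Z) ^+ d,
    (toQ f *m horner_mx (toQ A) (pZtoQ Q) <= W)%MS &
    forall p : {poly rat}, p != 0 -> (size p < size Q)%N ->
      ~~ (toQ f *m horner_mx (toQ A) p <= W)%MS].
Proof.
move=> WZ WA ZA fZ rZ AL.
pose ann := [pred p : {poly rat} | (p != 0) && (toQ f *m horner_mx (toQ A) p <= W)%MS].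
have [p0 [p0n0 p0d p0W]] := exists_annihilator WZ ZA fZ rZ.
have [p [pd pann pmin]] : exists p : {poly rat},
    [/\ (size p <= d.+1)%N, ann p & forall q, ann q -> (size p <= size q)%N].
  have [m] := ubnP (size p0).
  elim: m p0 p0n0 p0d p0W => // m IHm p p0 pd pW /ltnSE pm.
  have [[q]|] := boolp.pselect (exists q, ann q /\ (size q < size p)%N).
    case=> /andP[q0 qW] qp; apply: (IHm q) => //; first by rewrite (leq_trans (ltnW qp)).
    exact: leq_trans qp pm.
  move=> nq; exists p; split=> //; first by rewrite inE p0 pW.
  by move=> q qann; rewrite leqNgt; apply/negP=> qp; apply: nq; exists q.
case/andP: pann => p0' pW.
have pdvd : p %| pZtoQ (char_poly A).
  apply/negbNE; apply/negP=> ndv.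
  have /pmin : ann (pZtoQ (char_poly A) %% p).
    rewrite inE -/(dvdp _ _) ndv /=.
    have -> : pZtoQ (char_poly A) %% p = pZtoQ (char_poly A) - p * (pZtoQ (char_poly A) %/ p).
      by rewrite [X in X - _](divp_eq _ p) [p * _]mulrC addrAC subrr add0r.
    rewrite rmorphB rmorphM /= map_char_poly Cayley_Hamilton sub0r mulmxN eqmx_opp.
    rewrite -[_ * _]/(_ *m _) mulmxA.
    exact: submx_trans (submxMr _ pW) (stablemx_horner _ WA).
  by rewrite leqNgt ltn_modp p0'.
have [p1 [a a0 pE] [r pr]] := dvdpP_rat_int pdvd.
have lc1 : lead_coef p1 * lead_coef r = 1.
  by rewrite -lead_coefM -pr; exact: monicP (char_poly_monic A).
(* The leading coefficients of p1 and r are both 1 or both -1. *)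
pose e := lead_coef r; pose Q := e *: p1.
have ee : e ^+ 2 = 1.
  have : e \is a GRing.unit by apply/unitrPr; exists (lead_coef p1); rewrite mulrC.
  by rewrite qualifE /= => /orP[] /eqP ->.
have e0 : e != 0 by apply/eqP=> e0; move: ee; rewrite e0 expr0n.
have Qmonic : Q \is monic by rewrite monicE lead_coefZ mulrC lc1.
have sQ : size Q = size p by rewrite pE !size_scale ?size_map_inj_poly //; exact: intr_inj.
have QE : pZtoQ Q = (e%:~R / a) *: p by rewrite pE scalerA divfK // -map_polyZ.
exists Q; split=> //; first by rewrite sQ.
- move=> k.
  have [s sE] := closed_field_poly_normal (map_poly (intr : int -> algC) Q).
  have inj_intr : injective (intr : int -> algC) by exact: intr_inj.
  have QCmonic : lead_coef (map_poly (intr : int -> algC) Q) = 1.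
    by rewrite lead_coef_map_inj // (monicP Qmonic).
  rewrite QCmonic scale1r in sE.
  have szs : (size s <= d)%N.
    by rewrite -ltnS -(size_prod_XsubC s id) -sE size_map_inj_poly // sQ.
  have : `|(map_poly (intr : int -> algC) Q)`_k| <= (1 + L%:R) ^+ size s.
    rewrite sE; apply: coef_prod_XsubC_le => [|z zs]; first exact: ler0n.
    apply: (root_char_poly_le AL).
    rewrite -map_char_poly pr -[p1 * r]scale1r -ee expr2 -scalerA scalerAr scalerAl.
    rewrite rmorphM /= rootM; apply/orP; left; rewrite -[_ *: p1]/Q sE.
    by rewrite root_prod_XsubC.
  rewrite coef_map /= -intr_norm => /le_trans; move/(_ ((1 + L%:R) ^+ d)).
  rewrite ler_weXn2l ?lerDl ?ler0n // => /(_ isT).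
  by rewrite -(ler_int algC) rmorphXn rmorphD /=.
- rewrite QE -mul_polyC rmorphM /= horner_mx_C -[_ * _]/(_ *m _) mul_scalar_mx.
  by rewrite -scalemxAr scalemx_sub.
move=> q q0; rewrite sQ ltnNge; apply: contra => qW.
by apply: pmin; rewrite inE q0.
Qed.

(** * Cochains of the graph of squares *)

(** The inverses of T (for true) and S (for false) as substitutions: the vertical
    generator v becomes the path v then h, or the horizontal generator h becomes
    h then v.  Only these two directions are positive, i.e. replace an edge by a
    path without backward steps. *)
Definition move n (b : bool) (o : sqpair n) : sqpair n :=
  if b then (o.1, (o.2 * o.1)%g) else ((o.1 * o.2)%g, o.2).

Definition moves n (l : seq bool) (o : sqpair n) : sqpair n := foldl (fun o b => move b o) o l.

Definition conj_pair n (o : sqpair n) (s : 'S_n) : sqpair n := ((o.1 ^ s)%g, (o.2 ^ s)%g).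

(** The four squares met when turning around the upper right corner of square i
    close up exactly when this corner is not a zero. *)
Definition regular n (o : sqpair n) (i : 'I_n) : bool := o.1 (o.2 i) == o.2 (o.1 i).

Section Cochains.

Variables (R : comNzRingType) (n : nat).
Implicit Types (o : sqpair n) (f : 'rV[R]_(n + n)) (g : 'rV[R]_n) (s : 'S_n).

(** A cochain f assigns a value to each edge of the graph whose vertices are the
    squares: hval f i to the edge from i to h i and vval f i to the edge from i to
    v i.  Cochains are row vectors, so that operators compose from left to right
    like permutations. *)
Definition hval f i : R := f 0 (lshift n i).
Definition vval f i : R := f 0 (rshift n i).

Lemma cochainP f f' : hval f =1 hval f' -> vval f =1 vval f' -> f = f'.
Proof.
move=> hE vE; apply/rowP=> j; rewrite -(splitK j).
by case: (fintype.split j) => i /=; [apply: hE | apply: vE].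
Qed.

(** The value of f *m move_mx b o on an edge of move b o is the sum of the values
    of f along the path of o which that edge stands for. *)
Definition move_mx (b : bool) o : 'M[R]_(n + n) :=
  if b then block_mx 1%:M (perm_mx (o.2^-1)%g) 0 1%:M
  else block_mx 1%:M 0 (perm_mx (o.1^-1)%g) 1%:M.

Fixpoint moves_mx (l : seq bool) o : 'M[R]_(n + n) :=
  if l is b :: l' then move_mx b o *m moves_mx l' (move b o) else 1%:M.

Definition relabel_mx s : 'M[R]_(n + n) := block_mx (perm_mx (s^-1)%g) 0 0 (perm_mx (s^-1)%g).

Definition coboundary_mx o : 'M[R]_(n, n + n) :=
  row_mx (perm_mx (o.1^-1)%g - 1%:M) (perm_mx (o.2^-1)%g - 1%:M).

(** Entry i of f *m corner_mx o is the sum of f around the upper right corner of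
    square i: through h i, then against the path through v i (see [cornerE]). *)
Definition corner_mx o : 'M[R]_(n + n, n) :=
  col_mx (1%:M - perm_mx (o.2^-1)%g) (perm_mx (o.1^-1)%g - 1%:M).

Definition const_cochain (x : 'rV[R]_2) : 'rV[R]_(n + n) :=
  row_mx (const_mx (x 0 0)) (const_mx (x 0 1)).

(** The push-forward of f to the torus. *)
Definition csum f : 'rV[R]_2 := \row_k (if k == 0 then \sum_i hval f i else \sum_i vval f i).

(** No condition is imposed at the zeros: for a surface with a single zero the sum
    around it vanishes as soon as the sums around all other corners do. *)
Definition cocycle o f : Prop := forall i, regular o i -> (f *m corner_mx o) 0 i = 0.

Lemma mul_perm_mxE g s i : (g *m perm_mx (s^-1)%g) 0 i = g 0 (s i).
Proof. by rewrite -col_permE mxE. Qed.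

Lemma hval_row_mx g g' i : hval (row_mx g g') i = g 0 i.
Proof. by rewrite /hval row_mxEl. Qed.

Lemma vval_row_mx g g' i : vval (row_mx g g') i = g' 0 i.
Proof. by rewrite /vval row_mxEr. Qed.

Lemma cochain_split f : f = row_mx (\row_i hval f i) (\row_i vval f i).
Proof. by apply: cochainP => i; rewrite (hval_row_mx, vval_row_mx) mxE. Qed.

Lemma hval_move b o f i :
  hval (f *m move_mx b o) i = hval f i + (if b then 0 else vval f (o.1 i)).
Proof.
rewrite [in LHS](cochain_split f) /move_mx.
case: b; rewrite mul_row_block hval_row_mx !mulmx1 ?mulmx0.
  by rewrite mxE !mxE.
by rewrite mxE mul_perm_mxE !mxE.
Qed.

Lemma vval_move b o f i :
  vval (f *m move_mx b o) i = vval f i + (if b then hval f (o.2 i) else 0).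
Proof.
rewrite [in LHS](cochain_split f) /move_mx.
case: b; rewrite mul_row_block vval_row_mx !mulmx1 ?mulmx0.
  by rewrite mxE mul_perm_mxE !mxE addrC.
by rewrite mxE !mxE addrC.
Qed.

Lemma hval_relabel s f i : hval (f *m relabel_mx s) i = hval f (s i).
Proof.
by rewrite [in LHS](cochain_split f) mul_row_block hval_row_mx mulmx0 addr0 mul_perm_mxE mxE.
Qed.

Lemma vval_relabel s f i : vval (f *m relabel_mx s) i = vval f (s i).
Proof.
by rewrite [in LHS](cochain_split f) mul_row_block vval_row_mx mulmx0 add0r mul_perm_mxE mxE.
Qed.

Lemma hval_coboundary o g i : hval (g *m coboundary_mx o) i = g 0 (o.1 i) - g 0 i.
Proof. by rewrite mul_mx_row hval_row_mx mulmxBr mulmx1 mxE mul_perm_mxE mxE. Qed.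

Lemma vval_coboundary o g i : vval (g *m coboundary_mx o) i = g 0 (o.2 i) - g 0 i.
Proof. by rewrite mul_mx_row vval_row_mx mulmxBr mulmx1 mxE mul_perm_mxE mxE. Qed.

Lemma cornerE o f i :
  (f *m corner_mx o) 0 i = hval f i + vval f (o.1 i) - vval f i - hval f (o.2 i).
Proof.
rewrite [in LHS](cochain_split f) mul_row_col mulmxBr mulmxBr !mulmx1.
set a := \row_j hval f j; set b := \row_j vval f j.
have -> (x y z t : 'rV[R]_n) : (x - y + (z - t)) 0 i = x 0 i + z 0 i - t 0 i - y 0 i.
  by rewrite !mxE; ring.
by rewrite !mul_perm_mxE !mxE.
Qed.

Lemma hval_const x i : hval (const_cochain x) i = x 0 0.
Proof. by rewrite hval_row_mx mxE. Qed.

Lemma vval_const x i : vval (const_cochain x) i = x 0 1.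
Proof. by rewrite vval_row_mx mxE. Qed.

Lemma hvalD f f' i : hval (f + f') i = hval f i + hval f' i. Proof. by rewrite /hval mxE. Qed.
Lemma vvalD f f' i : vval (f + f') i = vval f i + vval f' i. Proof. by rewrite /vval mxE. Qed.
Lemma hvalZ c f i : hval (c *: f) i = c * hval f i. Proof. by rewrite /hval mxE. Qed.
Lemma vvalZ c f i : vval (c *: f) i = c * vval f i. Proof. by rewrite /vval mxE. Qed.
Lemma hvalN f i : hval (- f) i = - hval f i. Proof. by rewrite /hval mxE. Qed.
Lemma vvalN f i : vval (- f) i = - vval f i. Proof. by rewrite /vval mxE. Qed.

Definition cochainE := (hval_move, vval_move, hval_relabel, vval_relabel, hval_coboundary,
  vval_coboundary, hval_const, vval_const, hvalD, vvalD, hvalZ, vvalZ, hvalN, vvalN).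

(** The two sides of the commutation relation at i receive the same extra letter. *)
Lemma regular_move b o i : regular (move b o) i = regular o i.
Proof.
by case: b; rewrite /regular /move /= !permM (inj_eq perm_inj).
Qed.

Lemma cocycle_move b o f : cocycle o f -> cocycle (move b o) (f *m move_mx b o).
Proof.
move=> cf i; rewrite regular_move => ri; rewrite -(cf i ri) !cornerE !cochainE.
move/eqP: ri => ri; case: b => /=; rewrite !permM -?ri; ring.
Qed.

Lemma coboundary_move b o : coboundary_mx o *m move_mx b o = coboundary_mx (move b o).
Proof.
apply/row_matrixP=> k; rewrite 2!rowE mulmxA; apply: cochainP => i; rewrite !cochainE;
  case: b => /=; rewrite ?permM; ring.
Qed.

End Cochains.

(** * Transport of cochains along a positive word *)

Section Words.

Variables (R : comNzRingType) (n : nat).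
Implicit Types (o : sqpair n) (f : 'rV[R]_(n + n)) (g : 'rV[R]_n) (s : 'S_n) (x : 'rV[R]_2).

(** How a move transforms the values of a constant cochain, and, equally, the two
    sums of any cochain. *)
Definition slope_mx (b : bool) : 'M[R]_2 := \matrix_(i, j) ((i == j) || (b == (i == 0)))%:R.

Definition slopes_mx (l : seq bool) : 'M[R]_2 := foldr (fun b A => slope_mx b *m A) 1%:M l.

Lemma slope_mxE b x :
  (x *m slope_mx b) 0 0 = x 0 0 + (if b then 0 else x 0 1) /\
  (x *m slope_mx b) 0 1 = x 0 1 + (if b then x 0 0 else 0).
Proof.
rewrite !mxE !big_ord_recl !big_ord0 !mxE.
have -> : lift ord0 ord0 = 1 :> 'I_2 by apply/val_inj.
by case: b => /=; split; ring.
Qed.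

Lemma row2P x x' : x 0 0 = x' 0 0 -> x 0 1 = x' 0 1 -> x = x'.
Proof.
move=> e0 e1; apply/rowP=> k; rewrite -(inord_val k); case: k => [[|[|//]]] /= _.
  by rewrite (_ : inord 0 = 0) //; apply/val_inj; rewrite /= inordK.
by rewrite (_ : inord 1 = 1) //; apply/val_inj; rewrite /= inordK.
Qed.

Lemma csum0 f : csum f 0 0 = \sum_i hval f i. Proof. by rewrite mxE. Qed.
Lemma csum1 f : csum f 0 1 = \sum_i vval f i. Proof. by rewrite mxE. Qed.

Lemma csumD f f' : csum (f + f') = csum f + csum f'.
Proof.
apply/rowP=> k; rewrite !mxE.
by case: (k == 0); rewrite -big_split; apply: eq_bigr => i _; rewrite cochainE.
Qed.

Lemma csumZ c f : csum (c *: f) = c *: csum f.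
Proof.
apply/rowP=> k; rewrite !mxE.
by case: (k == 0); rewrite mulr_sumr; apply: eq_bigr => i _; rewrite cochainE.
Qed.

Lemma csum_move b o f : csum (f *m move_mx R b o) = csum f *m slope_mx b.
Proof.
have [e0 e1] := slope_mxE b (csum f).
apply: row2P; rewrite (e0, e1) !csum0 !csum1.
  rewrite (eq_bigr _ (fun i _ => hval_move b o f i)) big_split /=; congr (_ + _).
  case: b {e0 e1}; first by rewrite big1.
  by rewrite [RHS](reindex_inj (@perm_inj _ o.1)).
rewrite (eq_bigr _ (fun i _ => vval_move b o f i)) big_split /=; congr (_ + _).
case: b {e0 e1}; last by rewrite big1.
by rewrite [RHS](reindex_inj (@perm_inj _ o.2)).
Qed.

Lemma const_move b o x :
  const_cochain n x *m move_mx R b o = const_cochain n (x *m slope_mx b).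
Proof.
have [e0 e1] := slope_mxE b x.
by apply: cochainP => i; rewrite !cochainE (e0, e1).
Qed.

Lemma csum_relabel s f : csum (f *m relabel_mx R s) = csum f.
Proof.
apply: row2P; rewrite ?csum0 ?csum1 [RHS](reindex_inj (@perm_inj _ s));
  by apply: eq_bigr => i _; rewrite cochainE.
Qed.

Lemma const_relabel s x : const_cochain n x *m relabel_mx R s = const_cochain n x.
Proof. by apply: cochainP => i; rewrite !cochainE. Qed.

Lemma conj_pair1 o s i : (conj_pair o s).1 (s i) = s (o.1 i).
Proof. by rewrite /= permJ. Qed.

Lemma conj_pair2 o s i : (conj_pair o s).2 (s i) = s (o.2 i).
Proof. by rewrite /= permJ. Qed.

Lemma cocycle_relabel o s f : cocycle (conj_pair o s) f -> cocycle o (f *m relabel_mx R s).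
Proof.
move=> cf i ri; have: regular (conj_pair o s) (s i).
  by rewrite /regular !(conj_pair1, conj_pair2) (inj_eq perm_inj).
by move=> /cf <-; rewrite !cornerE !cochainE !conj_pair1 !conj_pair2.
Qed.

Lemma coboundary_relabel o s :
  coboundary_mx R (conj_pair o s) *m relabel_mx R s = perm_mx (s^-1)%g *m coboundary_mx R o.
Proof.
apply/row_matrixP=> k; rewrite 2!rowE !mulmxA.
by apply: cochainP => i; rewrite !cochainE !mul_perm_mxE ?conj_pair1 ?conj_pair2.
Qed.

Lemma cocycle_moves l o f : cocycle o f -> cocycle (moves l o) (f *m moves_mx R l o).
Proof.
elim: l o f => [|b l IHl] o f cf /=; first by rewrite mulmx1.
by rewrite mulmxA; apply/IHl/cocycle_move.
Qed.

Lemma csum_moves l o f : csum (f *m moves_mx R l o) = csum f *m slopes_mx l.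
Proof.
elim: l o f => [|b l IHl] o f /=; first by rewrite !mulmx1.
by rewrite mulmxA IHl csum_move mulmxA.
Qed.

Lemma const_moves l o x :
  const_cochain n x *m moves_mx R l o = const_cochain n (x *m slopes_mx l).
Proof.
elim: l o x => [|b l IHl] o x /=; first by rewrite !mulmx1.
by rewrite mulmxA const_move IHl mulmxA.
Qed.

Lemma coboundary_moves l o : coboundary_mx R o *m moves_mx R l o = coboundary_mx R (moves l o).
Proof.
elim: l o => [|b l IHl] o /=; first by rewrite !mulmx1.
by rewrite mulmxA coboundary_move IHl.
Qed.

(** When moves l o = conj_pair o s, this is the operator induced on cochains of o by
    an affine homeomorphism of its surface. *)
Definition transport l o s : 'M[R]_(n + n) := moves_mx R l o *m relabel_mx R s.

Variables (l : seq bool) (o : sqpair n) (s : 'S_n).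
Hypothesis los : moves l o = conj_pair o s.

Lemma cocycle_transport f : cocycle o f -> cocycle o (f *m transport l o s).
Proof. by move=> cf; rewrite mulmxA; apply: cocycle_relabel; rewrite -los; apply: cocycle_moves. Qed.

Lemma csum_transport f : csum (f *m transport l o s) = csum f *m slopes_mx l.
Proof. by rewrite mulmxA csum_relabel csum_moves. Qed.

Lemma const_transport x : const_cochain n x *m transport l o s = const_cochain n (x *m slopes_mx l).
Proof. by rewrite mulmxA const_moves const_relabel. Qed.

Lemma coboundary_transport :
  coboundary_mx R o *m transport l o s = perm_mx (s^-1)%g *m coboundary_mx R o.
Proof. by rewrite mulmxA coboundary_moves los coboundary_relabel. Qed.

End Words.

Section MapCochains.

Variables (R S : comNzRingType) (u : {rmorphism R -> S}) (n : nat).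
Implicit Types (o : sqpair n) (f : 'rV[R]_(n + n)).

Lemma map_transport l o s : map_mx u (transport R l o s) = transport S l o s.
Proof.
rewrite /transport map_mxM /relabel_mx map_block_mx !map_perm_mx !map_mx0; congr (_ *m _).
elim: l o => [|b l IHl] o /=; first by rewrite map_mx1.
rewrite map_mxM IHl; congr (_ *m _).
by rewrite /move_mx; case: b; rewrite map_block_mx map_perm_mx !map_mx1 !map_mx0.
Qed.

Lemma map_slopes l : map_mx u (slopes_mx R l) = slopes_mx S l.
Proof.
elim: l => [|b l IHl] /=; first by rewrite map_mx1.
by rewrite map_mxM IHl; congr (_ *m _); apply/matrixP=> i j; rewrite !mxE rmorph_nat.
Qed.

Lemma map_coboundary o : map_mx u (coboundary_mx R o) = coboundary_mx S o.
Proof. by rewrite /coboundary_mx map_row_mx !map_mxB !map_perm_mx map_mx1. Qed.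

Lemma map_corner o : map_mx u (corner_mx R o) = corner_mx S o.
Proof. by rewrite /corner_mx map_col_mx !map_mxB !map_perm_mx map_mx1. Qed.

Lemma map_csum f : csum (map_mx u f) = map_mx u (csum f).
Proof.
by apply/rowP=> k; rewrite !mxE; case: (k == 0); rewrite rmorph_sum; apply: eq_bigr => i _;
   rewrite /hval /vval mxE.
Qed.

End MapCochains.

Section NormTransport.

Variables (R : numDomainType) (n : nat).
Implicit Types (o : sqpair n) (f : 'rV[R]_(n + n)).

Lemma sum_norm_cochain f : \sum_j `|f 0 j| = \sum_i `|hval f i| + \sum_i `|vval f i|.
Proof. exact: big_split_ord. Qed.

Lemma sum_norm_move b o f : \sum_j `|(f *m move_mx R b o) 0 j| <= 2 * \sum_j `|f 0 j|.
Proof.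
rewrite !sum_norm_cochain.
have h : \sum_i `|hval (f *m move_mx R b o) i| <=
    \sum_i `|hval f i| + (if b then 0 else \sum_i `|vval f i|).
  under eq_bigr do rewrite hval_move.
  case: b; first by rewrite addr0; under eq_bigr do rewrite addr0.
  rewrite [X in _ + X](reindex_inj (@perm_inj _ o.1)) -big_split /=.
  by apply: ler_sum => i _; apply: ler_normD.
have v : \sum_i `|vval (f *m move_mx R b o) i| <=
    \sum_i `|vval f i| + (if b then \sum_i `|hval f i| else 0).
  under eq_bigr do rewrite vval_move.
  case: b {h}; last by rewrite addr0; under eq_bigr do rewrite addr0.
  rewrite [X in _ + X](reindex_inj (@perm_inj _ o.2)) -big_split /=.
  by apply: ler_sum => i _; apply: ler_normD.
apply: le_trans (lerD h v) _; rewrite mulr_natl mulr2n addrACA lerD2l.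
by case: b {h v}; rewrite ?addr0 ?add0r (lerDl, lerDr) sumr_ge0.
Qed.

Lemma sum_norm_transport l o s f :
  \sum_j `|(f *m transport R l o s) 0 j| <= (2 ^ size l)%:R * \sum_j `|f 0 j|.
Proof.
rewrite mulmxA; have -> f' : \sum_j `|(f' *m relabel_mx R s) 0 j| = \sum_j `|f' 0 j|.
  rewrite !sum_norm_cochain; congr (_ + _); rewrite [RHS](reindex_inj (@perm_inj _ s));
  by apply: eq_bigr => i _; rewrite cochainE.
elim: l o f => [|b l IHl] o f /=; first by rewrite mulmx1 expn0 mul1r.
rewrite mulmxA; apply: le_trans (IHl _ _) _; rewrite expnSr natrM -mulrA ler_wpM2l ?ler0n //.
exact: sum_norm_move.
Qed.

End NormTransport.

(** * Consequences of primitivity *)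

Lemma gen_ind (gT : finGroupType) (A : {set gT}) (P : gT -> Prop) :
  P 1%g -> (forall x y, x \in A -> P y -> P (x * y)%g) -> forall x, x \in <<A>>%g -> P x.
Proof.
move=> P1 PM x /gen_prodgP[m [c cA ->]].
elim: m c cA => [|m IHm] c cA; first by rewrite big_ord0.
by rewrite big_ord_recl; apply: PM => //; apply: IHm => k; apply: cA.
Qed.

Section Primitive.

Variables (n : nat) (o : sqpair n).
Hypothesis prim : primitive_origami o.

Local Notation G := <<[set o.1; o.2]>>%G.

(** Transitivity of the monodromy group, as an induction principle. *)
Lemma primitive_ind (P : 'I_n -> Prop) :
  (forall i, P i -> P (o.1 i)) -> (forall i, P i -> P (o.2 i)) -> forall i j, P i -> P j.
Proof.
move=> P1 P2 i j Pi.
have /atransP2 tr := proj1 (andP prim).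
have [g gG ->] := tr i j (in_setT _) (in_setT _).
rewrite /= apermE; move: i Pi {tr j}.
apply: (@gen_ind _ _ (fun g : 'S_n => forall i, P i -> P (g i)) _ _ g gG).
  by move=> i Pi; rewrite perm1.
by move=> x y /set2P[] -> Py i Pi; rewrite permM; apply: Py; [apply: P1 | apply: P2].
Qed.

Hypothesis ncomm : [~ o.1, o.2]%g != 1%g.

(** A nontrivial normal subgroup of a primitive group is transitive. *)
Lemma der_transitive i j : exists2 g, g \in (G^`(1))%g & j = g i.
Proof.
have [H1|tr] := prim_trans_norm prim (der_normal 1 G); last first.
  by have [g gG ->] := atransP2 tr (in_setT i) (in_setT j); exists g.
have cG : [~ o.1, o.2]%g \in (G^`(1))%g.
  by rewrite derg1 mem_commg // mem_gen // !inE eqxx ?orbT.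
case/negP: ncomm; apply/eqP/permP=> k; rewrite perm1.
have /subsetP/(_ _ cG) := H1; rewrite inE => /andP[_ /astabP/(_ k (in_setT _))].
by rewrite /= apermE.
Qed.

(** For a property P x g that tracks a label x adding up along products, products
    of commutators have label zero; and they join any two squares.  The label is
    the holonomy of a path in [exists_unit_cochain], and the increment of a
    potential in [potential_integral]. *)
Lemma der_ind (V : zmodType) (P : V -> 'S_n -> Prop) (x1 x2 : V) :
  P x1 o.1 -> P x2 o.2 -> P 0 1%g ->
  (forall x y g k, P x g -> P y k -> P (x + y) (g * k)%g) ->
  (forall x g, P x g -> P (- x) g^-1%g) ->
  forall i j, exists2 g, P 0 g & j = g i.
Proof.
move=> P1 P2 P0 PM PV i j; have [g gG' ->] := der_transitive i j; exists g => //.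
have PG k : k \in G -> exists x, P x k.
  apply: (@gen_ind _ _ (fun k : 'S_n => exists x, P x k)); first by exists 0.
  by move=> a b /set2P[] -> [x Px]; [exists (x1 + x) | exists (x2 + x)]; apply: PM.
move: gG'; rewrite derg1; apply: gen_ind => // _ k /imset2P[a b aG bG ->] Pk.
have [x Pa] := PG a aG; have [y Pb] := PG b bG.
rewrite -[0]addr0; apply: (PM) => //.
have -> : 0 = - x + (- y + (x + y)) :> V by rewrite [x + y]addrC addKr addNr.
by rewrite commgEl conjgE; apply: (PM); [apply: PV | apply: (PM); [apply: PV | apply: PM]].
Qed.

End Primitive.

Lemma rank_invariant (F : fieldType) n (s t : 'S_n) (x y : F) : x != 0 -> y != 0 ->
  (forall q : 'I_n -> F, (forall i, q (s i) = q i) -> (forall i, q (t i) = q i) ->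
     forall i j, q i = q j) ->
  (n <= \rank (row_mx (x *: (perm_mx (s^-1)%g - 1%:M))
                      (y *: (perm_mx (t^-1)%g - 1%:M)) : 'M[F]_(n, n + n)) + 1)%N.
Proof.
move=> x0 y0 inv; set A := row_mx _ _.
suff : (\rank (kermx A) <= 1)%N by rewrite mxrank_ker leq_subLR.
have /mxrankS/leq_trans -> // : (kermx A <= (const_mx 1 : 'rV[F]_n))%MS; last exact: rank_leq_row.
apply/row_subP=> k; have : row k (kermx A) *m A = 0 by rewrite -row_mul mulmx_ker row0.
move: (row k _) => g; rewrite mul_mx_row -row_mx0 => /eq_row_mx[gs gt].
have fixed (r : 'S_n) z : z != 0 -> g *m (z *: (perm_mx r^-1%g - 1%:M)) = 0 ->
    forall i, g 0 (r i) = g 0 i.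
  move=> z0; rewrite -scalemxAr => /eqP; rewrite scaler_eq0 (negPf z0) /= mulmxBr mulmx1 subr_eq0.
  by move=> /eqP gr i; rewrite -mul_perm_mxE gr.
have {}inv := inv (g 0) (fixed _ _ x0 gs) (fixed _ _ y0 gt).
case: (posnP n) => [n0|n0].
  by rewrite (_ : g = 0) ?sub0mx //; apply/rowP=> -[i i_n]; exfalso; rewrite n0 in i_n.
rewrite (_ : g = g 0 (Ordinal n0) *: const_mx 1) ?scalemx_sub //.
by apply/rowP=> i; rewrite !mxE mulr1; apply: inv.
Qed.

Section PrimitiveCochains.

Variables (n : nat) (o : sqpair n).
Hypothesis prim : primitive_origami o.

Lemma rank_coboundary (F : fieldType) : (n <= \rank (coboundary_mx F o) + 1)%N.
Proof.
have := @rank_invariant F n o.1 o.2 1 1 (oner_neq0 _) (oner_neq0 _).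
rewrite !scale1r; apply=> q q1 q2 i j; apply/esym.
by apply: (primitive_ind prim (P := fun k => q k = q i)) => [k|k|//]; rewrite ?q1 ?q2.
Qed.

Lemma rank_corner (F : fieldType) : (n <= \rank (corner_mx F o) + 1)%N.
Proof.
rewrite -mxrank_tr tr_col_mx !raddfB /= trmx1 !tr_perm_mx.
have := @rank_invariant F n (o.2^-1)%g (o.1^-1)%g (-1) 1.
rewrite oppr_eq0 oner_eq0 scaleN1r opprB scale1r; apply=> // q q2 q1 i j; apply/esym.
apply: (primitive_ind prim (P := fun k => q k = q i)) => [k|k|//] <-.
  by rewrite -[in RHS](permK o.1 k) q1.
by rewrite -[in RHS](permK o.2 k) q2.
Qed.

Definition cocycle_mx (F : fieldType) : 'M[F]_(n + n) :=
  kermx (corner_mx F o *m diag_mx (\row_i (regular o i)%:R)).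

Lemma cocycle_mxP (F : fieldType) (f : 'rV[F]_(n + n)) :
  reflect (cocycle o f) (f <= cocycle_mx F)%MS.
Proof.
have E i : (f *m (corner_mx F o *m diag_mx (\row_i (regular o i)%:R))) 0 i =
    (f *m corner_mx F o) 0 i * (regular o i)%:R.
  by rewrite mulmxA mul_mx_diag !mxE.
apply: (iffP sub_kermxP) => [fK i ri | cf].
  by have := E i; rewrite fK ri mulr1 mxE.
apply/rowP=> i; rewrite E [RHS]mxE.
by case: (boolP (regular o i)) => [/cf ->|_]; rewrite (mul0r, mulr0).
Qed.

(** Dropping the condition at one singular corner costs at most one dimension, and
    the conditions at all corners have rank at least n - 1 by transitivity. *)
Lemma rank_cocycle (F : fieldType) :
  (\rank (cocycle_mx F) <= n + #|[set i | ~~ regular o i]| + 1)%N.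
Proof.
set S := [set i | _]; set d : 'rV[F]_n := \row_i (regular o i)%:R.
pose A : 'M[F]_(n, #|S|) := \matrix_(i, k) (i == enum_val k)%:R.
have dE : 1%:M = diag_mx d + A *m A^T.
  apply/matrixP=> i j; rewrite !mxE.
  under eq_bigr => k _ do rewrite !mxE -natrM mulnb.
  have [<-|ij] := eqVneq i j.
    under eq_bigr => k _ do rewrite andbb.
    have [ri|ri] := boolP (regular o i).
      rewrite big1 ?addr0 // => k _; case: eqP => // ik; have := enum_valP k.
      by rewrite -ik inE ri.
    have iS : i \in S by rewrite inE.
    rewrite add0r (bigD1 (enum_rank_in iS i)) //= enum_rankK_in // eqxx big1 ?addr0 //.
    move=> k /eqP kr; case: eqP => // ik; case: kr; apply: enum_val_inj.
    by rewrite enum_rankK_in // ik.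
  rewrite big1 ?addr0 ?mulr0n // => k _.
  by case: eqP => //= ik; case: eqP => // jk; rewrite ik jk eqxx in ij.
have := rank_corner F; rewrite -[corner_mx F o]mulmx1 dE mulmxDr => /leq_trans.
move/(_ _ (leq_add (mxrank_add _ _) (leqnn 1))).
have : (\rank (corner_mx F o *m (A *m A^T)) <= #|S|)%N.
  by rewrite mulmxA (leq_trans (mxrankM_maxr _ _)) // rank_leq_row.
rewrite /cocycle_mx mxrank_ker -/d. by move: (\rank _) (\rank _) => r1 r2; lia.
Qed.

(** The first cohomology of the surface punctured at its zeros has a dimension
    bounded in terms of the number of singular corners. *)
Lemma rank_cocycle_coboundary (F : fieldType) :
  (\rank (cocycle_mx F) <= \rank (coboundary_mx F o) + (#|[set i | ~~ regular o i]| + 2))%N.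
Proof. by have := rank_cocycle F; have := rank_coboundary F; lia. Qed.

Lemma cocycle_coboundary (R : comNzRingType) (g : 'rV[R]_n) : cocycle o (g *m coboundary_mx R o).
Proof. by move=> i /eqP ri; rewrite cornerE !cochainE ri; ring. Qed.

Lemma coboundary_cocycle (F : fieldType) : (coboundary_mx F o <= cocycle_mx F)%MS.
Proof. by apply/row_subP=> k; rewrite rowE; apply/cocycle_mxP/cocycle_coboundary. Qed.

Lemma csum_coboundary (R : comNzRingType) (g : 'rV[R]_n) : csum (g *m coboundary_mx R o) = 0.
Proof.
apply: row2P; rewrite ?csum0 ?csum1 mxE.
  under eq_bigr do rewrite cochainE.
  by rewrite sumrB [X in _ - X](reindex_inj (@perm_inj _ o.1)) subrr.
under eq_bigr do rewrite cochainE.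
by rewrite sumrB [X in _ - X](reindex_inj (@perm_inj _ o.2)) subrr.
Qed.

Hypothesis ncomm : [~ o.1, o.2]%g != 1%g.

(** Modulo 1 the function u turns h and v into translations by a and b.  Products
    of commutators then preserve u modulo 1, and they act transitively. *)
Lemma potential_integral (u : 'I_n -> rat) (a b : rat) : (0 < n)%N ->
  (forall i, u (o.1 i) - u i - a \is a Num.int) ->
  (forall i, u (o.2 i) - u i - b \is a Num.int) ->
  (a \is a Num.int) /\ (b \is a Num.int).
Proof.
move=> n0 ua ub.
have uij i j : u j - u i \is a Num.int.
  have : exists2 g : 'S_n, forall i, u (g i) - u i - 0 \is a Num.int & j = g i.
    apply: (@der_ind n o prim ncomm _
      (fun x (g : 'S_n) => forall i, u (g i) - u i - x \is a Num.int) a b ua ub).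
    - by move=> k; rewrite perm1 subrr subr0 rpred0.
    - move=> x y g k Pg Pk m; rewrite permM.
      rewrite (_ : _ - _ = u (k (g m)) - u (g m) - y + (u (g m) - u m - x)); last by ring.
      exact: rpredD.
    - move=> x g Pg m; rewrite -rpredN; have := Pg (g^-1%g m); rewrite permKV.
      by rewrite (_ : u m - _ - x = - (u (g^-1%g m) - u m - - x)) //; ring.
  by move=> [g Pg ->]; have := Pg i; rewrite subr0.
pose i0 := Ordinal n0.
split.
  by have := rpredB (uij i0 (o.1 i0)) (ua i0); rewrite opprB addrC subrK.
by have := rpredB (uij i0 (o.2 i0)) (ub i0); rewrite opprB addrC subrK.
Qed.

(** The cochain counts the signed crossings of a path drawn along the sides of the
    squares.  A path from the lower left corner of square j to the one of square
    g j has boundary at these two corners only.  Following h once and coming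
    back by a product of commutators gives a closed path, whose holonomy is that of
    h; a step along a horizontal side crosses a vertical edge, whence the value
    (0, 1). *)
Lemma exists_unit_cochain : (0 < n)%N ->
  exists2 f : 'rV[int]_(n + n), cocycle o f & csum f = delta_mx 0 1.
Proof.
move=> n0; pose j0 := Ordinal n0.
pose walk (x : 'rV[int]_2) (g : 'S_n) := forall j, exists2 f : 'rV[int]_(n + n), csum f = x &
  forall i, regular o i ->
    (f *m corner_mx _ o) 0 i = (o.2 (o.1 i) == j)%:R - (o.2 (o.1 i) == g j)%:R.
(* The bottom side of square j crosses the vertical edge that ends at j. *)
have walk1 : walk (delta_mx 0 1) o.1.
  move=> j; exists (row_mx 0 (\row_i (o.2 i == j)%:R)).
    apply: row2P; rewrite ?csum0 ?csum1 !mxE /=.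
      by rewrite big1 // => i _; rewrite hval_row_mx mxE.
    under eq_bigr do rewrite vval_row_mx mxE.
    rewrite (bigD1 (o.2^-1 j)%g) //= permKV eqxx big1 ?addr0 // => i /eqP ij.
    by case: eqP => // ji; case: ij; rewrite -ji permK.
  move=> i /eqP ri; rewrite cornerE !hval_row_mx !vval_row_mx !mxE -ri (inj_eq perm_inj).
  by rewrite ri; ring.
(* The left side of square j crosses the horizontal edge that ends at j, with the
   opposite orientation. *)
have walk2 : walk (- delta_mx 0 0) o.2.
  move=> j; exists (row_mx (\row_i - (o.1 i == j)%:R) 0).
    apply: row2P; rewrite ?csum0 ?csum1 !mxE /=; last first.
      by rewrite big1 // => i _; rewrite vval_row_mx mxE.
    under eq_bigr do rewrite hval_row_mx mxE.
    rewrite (bigD1 (o.1^-1 j)%g) //= permKV eqxx big1 ?addr0 // => i /eqP ij.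
    by case: eqP => // ji; case: ij; rewrite -ji permK.
  move=> i /eqP ri; rewrite cornerE !hval_row_mx !vval_row_mx !mxE ri (inj_eq perm_inj).
  by ring.
have [g walkg ghj] : exists2 g, walk 0 g & o.1 j0 = g j0.
  apply: (@der_ind n o prim ncomm _ walk _ _ walk1 walk2).
  - move=> j; exists 0; first by rewrite -[0 in LHS](scale0r 0) csumZ scale0r.
    by move=> i _; rewrite mul0mx mxE perm1 subrr.
  - move=> x y g k wg wk j; have [f fx fg] := wg j; have [f' fy fk] := wk (g j).
    exists (f + f').
      by rewrite csumD fx fy.
    by move=> i ri; rewrite mulmxDl mxE fg // fk // permM; ring.
  - move=> x g wg j; have [f fx fg] := wg (g^-1%g j); exists (- f).
      by rewrite -scaleN1r csumZ fx scaleN1r.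
    by move=> i ri; rewrite mulNmx mxE fg // permKV; ring.
have [f fx fh] := walk1 j0; have [f' fx' fg] := walkg j0.
exists (f - f').
  by move=> i ri; rewrite mulmxBl mxE fh // mxE fg // ghj; ring.
by rewrite -scaleN1r csumD csumZ fx fx' scaler0 addr0.
Qed.

End PrimitiveCochains.

(** * The Perron-Frobenius argument *)

Section Perron.

Variables (R : realFieldType) (n : nat).
Implicit Types (o : sqpair n) (f : 'rV[R]_(n + n)).

Definition nonpos f : Prop := (forall i, hval f i <= 0) /\ (forall i, vval f i <= 0).
Definition hzero f : {set 'I_n} := [set i | hval f i == 0].
Definition vzero f : {set 'I_n} := [set i | vval f i == 0].

Lemma zeros_move b o f : nonpos f ->
  [/\ nonpos (f *m move_mx R b o), hzero (f *m move_mx R b o) \subset hzero f &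
      vzero (f *m move_mx R b o) \subset vzero f].
Proof.
case=> h0 v0; split.
- by split=> i; rewrite cochainE; case: b; rewrite ?addr0 // -[0]addr0 lerD.
- apply/subsetP=> i; rewrite !inE cochainE; case: b; rewrite ?addr0 // naddr_eq0 //.
  by case/andP.
- apply/subsetP=> i; rewrite !inE cochainE; case: b; rewrite ?addr0 // naddr_eq0 //.
  by case/andP.
Qed.

(** Adding nonpositive values can only destroy zeros. *)
Lemma zeros_moves l o f : nonpos f ->
  [/\ nonpos (f *m moves_mx R l o), hzero (f *m moves_mx R l o) \subset hzero f &
      vzero (f *m moves_mx R l o) \subset vzero f].
Proof.
elim: l o f => [|b l IHl] o f f0 /=; first by rewrite mulmx1.
have [f1 h1 v1] := zeros_move b o f0; have [f2 h2 v2] := IHl (move b o) _ f1.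
by rewrite mulmxA; split=> //; [apply: subset_trans h2 h1 | apply: subset_trans v2 v1].
Qed.

(** The zeros of f survive the whole word. *)
Definition stationary l o f :=
  [/\ nonpos f, hzero (f *m moves_mx R l o) = hzero f & vzero (f *m moves_mx R l o) = vzero f].

Lemma stationary_cons b l o f : stationary (b :: l) o f ->
  [/\ stationary l (move b o) (f *m move_mx R b o),
      hzero (f *m move_mx R b o) = hzero f & vzero (f *m move_mx R b o) = vzero f].
Proof.
rewrite /stationary /= mulmxA => -[f0 h v]; have [f1 h1 v1] := zeros_move b o f0.
have [_ h2 v2] := zeros_moves l (move b o) f1.
rewrite h v in h2 v2 *.
have hE : hzero (f *m move_mx R b o) = hzero f by apply/eqP; rewrite eqEsubset h1.
have vE : vzero (f *m move_mx R b o) = vzero f by apply/eqP; rewrite eqEsubset v1.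
by rewrite hE vE; split.
Qed.

(** The zero sets are the same at every stage, and a letter true does not change
    h, nor false v.  At the first letter true, the new value at a vertical zero i
    is still zero, so the edge that the move appends at v i is a horizontal zero;
    likewise for false. *)
Lemma stationary_zeros l o f : stationary l o f ->
  (true \in l -> o.2 @: vzero f \subset hzero f) /\
  (false \in l -> o.1 @: hzero f \subset vzero f).
Proof.
elim: l o f => [|b l IHl] o f st; first by split.
have [st1 hE vE] := stationary_cons st; have [[h0 v0] _ _] := st.
have {IHl} := IHl _ _ st1; rewrite hE vE !inE.
case: b {st st1} hE vE => hE vE [IHt IHf]; split=> //= _; try by [apply: IHt | apply: IHf].
- apply/subsetP=> _ /imsetP[i iv ->].
  by move: (iv); rewrite -{1}vE !inE cochainE naddr_eq0 // => /andP[].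
- apply/subsetP=> _ /imsetP[i ih ->].
  by move: (ih); rewrite -{1}hE !inE cochainE naddr_eq0 // => /andP[].
Qed.

(** Write H and V for the sets of horizontal and vertical zeros.  Then v
    maps V into H and h maps H into V, so H and V have the same cardinality.  After
    the first letter, say false, the new horizontal permutation, h then v, maps H
    both onto itself and onto V; hence H = V is stable under h and v.  This second
    use of [stationary_zeros] is why both letters must occur after the first. *)
Lemma stationary_all_zero b l o f : primitive_origami o -> stationary (b :: l) o f ->
  true \in l -> false \in l -> (exists j, f 0 j = 0) -> f = 0.
Proof.
move=> prim st tl fl f0.
have [st1 hE vE] := stationary_cons st.
have [vh hv] := stationary_zeros st; have [vh1 hv1] := stationary_zeros st1.
rewrite {}hE {}vE in vh1 hv1.
have {}vh : o.2 @: vzero f \subset hzero f by apply: vh; rewrite inE tl orbT.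
have {}hv : o.1 @: hzero f \subset vzero f by apply: hv; rewrite inE fl orbT.
have {vh1}vh1 := vh1 tl; have {hv1}hv1 := hv1 fl.
have card_img (g : 'S_n) (A : {set 'I_n}) : #|g @: A| = #|A|.
  by rewrite card_imset //; apply: perm_inj.
have imgM (g k : 'S_n) (A : {set 'I_n}) : (g * k)%g @: A = k @: (g @: A).
  by rewrite -imset_comp; apply: eq_imset => i; rewrite permM.
have cE : #|hzero f| = #|vzero f|.
  apply/eqP; rewrite eqn_leq -{1}(card_img o.1) (subset_leq_card hv).
  by rewrite -{1}(card_img o.2) (subset_leq_card vh).
have hvE : hzero f = vzero f.
  apply/eqP; case: b {st st1} vh1 hv1 => /= vh1 hv1.
    have -> : hzero f = (o.2 * o.1)%g @: vzero f.
      by apply/esym/eqP; rewrite eqEcard vh1 card_img cE leqnn.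
    rewrite eqEcard card_img leqnn andbT imgM.
    exact: subset_trans (imsetS _ vh) hv.
  have -> : vzero f = (o.1 * o.2)%g @: hzero f.
    by apply/esym/eqP; rewrite eqEcard hv1 card_img cE leqnn.
  rewrite eq_sym eqEcard card_img leqnn andbT imgM.
  exact: subset_trans (imsetS _ hv) vh.
have [i0 i0f] : exists i, i \in hzero f.
  have [j] := f0; rewrite -(splitK j).
  by case: (fintype.split j) => i /= fi; exists i; [rewrite inE /hval fi | rewrite hvE inE /vval fi].
have all0 i : i \in hzero f.
  apply: (primitive_ind prim (P := fun i => i \in hzero f)) i0f => k kf.
    by rewrite [in X in _ \in X]hvE (subsetP hv) // imset_f.
  by rewrite (subsetP vh) // imset_f // -hvE.
apply: cochainP => i; first by have := all0 i; rewrite inE => /eqP ->; rewrite /hval mxE.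
by have := all0 i; rewrite hvE inE => /eqP ->; rewrite /vval mxE.
Qed.

(** Subtracting from f the largest multiple m of the positive constant eigenvector
    that touches it leaves a nonpositive eigenvector with a zero.  Its zeros are
    merely relabelled by the word, so they are stationary and f = m y; the vanishing
    of the sums gives m = 0. *)
Lemma perron b l o s f (y : 'rV[R]_2) lam : primitive_origami o ->
  moves (b :: l) o = conj_pair o s -> true \in l -> false \in l ->
  0 < lam -> (forall k, 0 < y 0 k) -> y *m slopes_mx R (b :: l) = lam *: y ->
  f *m transport R (b :: l) o s = lam *: f -> csum f = 0 -> f = 0.
Proof.
move=> prim los tl fl lam0 y0 yE fE f0.
case: (posnP n) => [n0|n0].
  by apply/rowP=> -[i i_n]; exfalso; rewrite n0 in i_n.
have [c cE] : exists c, c = const_cochain n y by exists (const_cochain n y).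
pose j0 : 'I_(n + n) := lshift n (Ordinal n0).
have c0 j : 0 < c 0 j.
  rewrite cE -(splitK j).
  by case: (fintype.split j) => i; [have := hval_const y i | have := vval_const y i];
     rewrite /hval /vval => ->.
have [j _ jmax] := @arg_maxP _ _ 'I_(n + n) j0 xpredT (fun j => f 0 j / c 0 j) isT.
pose m := f 0 j / c 0 j; pose f' := f - m *: c.
have f'np k : f' 0 k <= 0.
  by rewrite !mxE subr_le0 -ler_pdivrMr //; exact: (jmax k isT).
have f'E : f' *m transport R (b :: l) o s = lam *: f'.
  have cT : c *m transport R (b :: l) o s = lam *: c.
    by rewrite cE const_transport yE; apply: cochainP => i; rewrite !cochainE mxE.
  by rewrite mulmxBl -scalemxAl fE cT scalerBr !scalerA [lam * m]mulrC.
have f'0 : f' = 0.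
  apply: (stationary_all_zero prim (b := b) (l := l) _ tl fl); last first.
    by exists j; rewrite !mxE divfK ?subrr // gt_eqF.
  have np : nonpos f' by split=> i; apply: f'np.
  have [_ hs vs] := zeros_moves (b :: l) o np.
  split=> //; apply/eqP; rewrite eqEcard (hs, vs) /=.
    rewrite -(card_imset _ (@perm_inj _ s)) subset_leq_card //.
    apply/subsetP=> _ /imsetP[i iz ->]; rewrite inE -hval_relabel -mulmxA f'E cochainE.
    by move: iz; rewrite inE => /eqP ->; rewrite mulr0.
  rewrite -(card_imset _ (@perm_inj _ s)) subset_leq_card //.
  apply/subsetP=> _ /imsetP[i iz ->]; rewrite inE -vval_relabel -mulmxA f'E cochainE.
  by move: iz; rewrite inE => /eqP ->; rewrite mulr0.
have fmc : f = m *: c by apply/eqP; rewrite -subr_eq0; apply/eqP.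
suff m0 : m = 0 by rewrite fmc m0 scale0r.
have := congr1 (fun x : 'rV_2 => x 0 0) f0; rewrite fmc cE csumZ mxE csum0 mxE.
under eq_bigr do rewrite hval_const.
rewrite sumr_const card_ord => /eqP.
by rewrite mulf_eq0 mulrn_eq0 (gt_eqF (y0 0)) orbF eqn0Ngt n0 orbF => /eqP.
Qed.

End Perron.

(** * The matrix of a positive word *)

Lemma lift01 : lift ord0 ord0 = 1 :> 'I_2. Proof. exact/val_inj. Qed.

Lemma mul_mx22 (R : comNzRingType) k (A : 'M[R]_(k, 2)) (B : 'M[R]_(2, 2)) i j :
  (A *m B) i j = A i 0 * B 0 j + A i 1 * B 1 j.
Proof. by rewrite mxE !big_ord_recl big_ord0 lift01 addr0. Qed.

Lemma det_mx22 (R : comNzRingType) (A : 'M[R]_2) : \det A = A 0 0 * A 1 1 - A 0 1 * A 1 0.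
Proof.
have l10 : lift (1 : 'I_2) 0 = 0 by apply/val_inj.
have l00 : lift (0 : 'I_2) 0 = 1 by apply/val_inj.
rewrite (expand_det_row _ 0) !big_ord_recl big_ord0 lift01 /cofactor !det_mx11 !mxE l10 l00 /=.
by rewrite expr0 expr1; ring.
Qed.

Lemma tr_mx22 (R : comNzRingType) (A : 'M[R]_2) : \tr A = A 0 0 + A 1 1.
Proof. by rewrite /mxtrace !big_ord_recl big_ord0 lift01 addr0. Qed.

Lemma char_poly22 (R : comNzRingType) (A : 'M[R]_2) :
  char_poly A = 'X^2 - (\tr A)%:P * 'X + (\det A)%:P.
Proof.
rewrite /char_poly /char_poly_mx !det_mx22 tr_mx22 !mxE /= !(rmorphD, rmorphB, rmorphM) /=; ring.
Qed.

Lemma slope_mx_mul (R : comNzRingType) b (A : 'M[R]_2) j :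
  (slope_mx R b *m A) 0 j = A 0 j + (if b then A 1 j else 0) /\
  (slope_mx R b *m A) 1 j = A 1 j + (if b then 0 else A 0 j).
Proof. by rewrite !mul_mx22 !mxE; case: b => /=; split; ring. Qed.

Lemma slopes_mx_pos (l : seq bool) :
  let: M := slopes_mx int l in
  [/\ 1 <= M 0 0 /\ 1 <= M 1 1, 0 <= M 0 1 /\ 0 <= M 1 0,
      true \in l -> 1 <= M 0 1, false \in l -> 1 <= M 1 0 & \det M = 1].
Proof.
elim: l => [|b l [[h00 h11] [h01 h10] ht hf hd]] /=; first by rewrite det1 !mxE.
have [e00 e10] := slope_mx_mul b (slopes_mx int l) 0.
have [e01 e11] := slope_mx_mul b (slopes_mx int l) 1.
have det1 : \det (slope_mx int b) = 1 by rewrite det_mx22 !mxE; case: b {e00 e01 e10 e11}.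
rewrite det_mulmx hd det1 e00 e01 e10 e11 !inE.
move: (_ 0 0) (_ 0 1) (_ 1 0) (_ 1 1) h00 h11 h01 h10 ht hf {e00 e01 e10 e11 hd det1}.
move=> A B C D hA hD hB hC hb hc.
move: (true \in l) (false \in l) hb hc => t f hb hc.
have {}hb : t -> 1 <= B := hb; have {}hc : f -> 1 <= C := hc.
by case: b; case: t hb => hb; case: f hc => hc; split; try split; rewrite //= ?hb ?hc //; lia.
Qed.

(** A rational algebraic integer is an integer. *)
Lemma char_poly_rational_root (N : nat) (A : 'M[int]_N.+1) (k : rat) :
  root (char_poly (toQ A)) k -> k \is a Num.int.
Proof.
move=> kr; have : (ratr k : algC) \in Num.int.
  apply: Cint_rat_Aint; first exact: Crat_rat.
  have pE : map_poly ratr (char_poly (toQ A)) = char_poly (map_mx (intr : int -> algC) A).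
    rewrite map_char_poly -map_mx_comp; congr char_poly; apply/matrixP=> i j.
    by rewrite !mxE /= ratr_int.
  apply: (@root_monic_Aint (char_poly (map_mx intr A))).
  - by rewrite -pE fmorph_root.
  - exact: char_poly_monic.
  - by rewrite -map_char_poly; apply/polyOverP=> i; rewrite coef_map /= intr_int.
case/intrP=> m /eqP; rewrite -(ratr_int algC) (inj_eq (fmorph_inj _)) => /eqP ->.
exact: intr_int.
Qed.

Lemma horner_mx_sum (R : comNzRingType) (N m : nat) (A : 'M[R]_N.+1) (p : {poly R}) :
  (size p <= m)%N -> horner_mx A p = \sum_(k < m) p`_k *: A ^+ k.
Proof.
move=> pm; have {1}-> : p = \poly_(k < m) p`_k.
  apply/polyP=> k; rewrite coef_poly; case: ltnP => // mk; rewrite nth_default //.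
  exact: leq_trans mk.
rewrite poly_def rmorph_sum; apply: eq_bigr => k _ /=.
by rewrite horner_mxZ rmorphXn /= horner_mx_X.
Qed.

Lemma dominant_eigenvector (F : rcfType) (M : 'M[int]_2) :
  1 <= M 0 0 -> 1 <= M 1 1 -> 1 <= M 0 1 -> 1 <= M 1 0 -> \det M = 1 ->
  exists lam : F, exists y : 'rV[F]_2, [/\ 1 < lam, forall k, 0 < y 0 k,
    y *m map_mx intr M = lam *: y & lam ^+ 2 - (\tr M)%:~R * lam + 1 = 0].
Proof.
rewrite det_mx22 tr_mx22.
move eA: (M 0 0) => A; move eB: (M 0 1) => B; move eC: (M 1 0) => C; move eD: (M 1 1) => D.
move=> A1 D1 B1 C1 det1.
pose t : F := (A + D)%:~R; have t3 : 3 <= t.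
  by rewrite /t (_ : 3 = 3%:~R) // ler_int; nia.
pose r := Num.sqrt (t ^+ 2 - 4).
have r2 : r ^+ 2 = t ^+ 2 - 4 by rewrite sqr_sqrtr //; nra.
have r0 : 0 <= r by exact: sqrtr_ge0.
have rgt0 : 0 < r by nra.
pose lam := (t + r) / 2.
have lamE : lam ^+ 2 - t * lam + 1 = 0.
  have -> : lam ^+ 2 - t * lam + 1 = (r ^+ 2 - t ^+ 2) / 4 + 1 by rewrite /lam; field.
  by rewrite r2; field.
have detF : A%:~R * D%:~R - B%:~R * C%:~R = 1 :> F by rewrite -!intrM -intrB det1.
have tE : t = A%:~R + D%:~R by rewrite /t intrD.
have BF : 1 <= B%:~R :> F by rewrite ler1z.
have CF : 1 <= C%:~R :> F by rewrite ler1z.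
(* The second row of the adjugate of M - lam, up to sign. *)
pose y : 'rV[F]_2 := \row_k (if k == 0 then C%:~R else lam - A%:~R).
exists lam, y; split.
- by rewrite /lam; lra.
- have AD : r ^+ 2 = (A%:~R - D%:~R) ^+ 2 + 4 * (B%:~R * C%:~R).
    by rewrite r2 tE; move: detF => /(canRL (subrK _)) dE; nra.
  have BC : 1 <= B%:~R * C%:~R :> F by nra.
  have : 0 < lam - A%:~R by rewrite /lam tE; nra.
  by move=> lA k; rewrite mxE; case: eqP => // _; lra.
- apply: row2P; rewrite mul_mx22 !mxE /= ?eA ?eB ?eC ?eD; first by ring.
  have -> : C%:~R * B%:~R = A%:~R * D%:~R - 1 :> F.
    by move/eqP: detF; rewrite subr_eq => /eqP ->; ring.
  have -> : D%:~R = t - A%:~R :> F by rewrite tE; ring.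
  have -> : lam * (lam - A%:~R) = (lam ^+ 2 - t * lam + 1) + t * lam - 1 - lam * A%:~R by ring.
  by rewrite lamE; ring.
exact: lamE.
Qed.

(** * The dominant eigenvalue does not recur *)

(** A permutation matrix preserves the l1 norm, so it has no eigenvalue lam > 1. *)
Lemma perm_scalar_unit (F : realFieldType) n (s : 'S_n) (lam : F) : 1 < lam ->
  lam%:M - perm_mx s \in unitmx.
Proof.
move=> lam1; rewrite -row_free_unit -kermx_eq0; apply/rowV0P=> x /sub_kermxP.
rewrite mulmxBr mul_mx_scalar => /eqP; rewrite subr_eq0 => /eqP xE.
have xEi i : `|lam| * `|x 0 i| = `|x 0 (s^-1%g i)|.
  have : (lam *: x) 0 i = (x *m perm_mx (s^-1)^-1%g) 0 i by rewrite invgK xE.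
  by rewrite mxE mul_perm_mxE -normrM => ->.
have : (`|lam| - 1) * \sum_i `|x 0 i| = 0.
  rewrite mulrBl mul1r mulr_sumr (eq_bigr _ (fun i _ => xEi i)).
  by rewrite [X in _ - X](reindex_inj (@perm_inj _ s^-1%g)) subrr.
move/eqP; rewrite mulf_eq0 subr_eq0 gt_eqF /=; last by rewrite gtr0_norm // (lt_trans _ lam1).
move/eqP/psumr_eq0P => x0; apply/rowP=> i; rewrite mxE; apply/normr0_eq0/x0 => //.
Qed.

Lemma horner_mx_quadratic (R : comNzRingType) (N : nat) (A : 'M[R]_N.+1) (c d : R) :
  horner_mx A ('X^2 - c%:P * 'X + d%:P) = A *m A - c *: A + d%:M.
Proof.
rewrite rmorphD rmorphB expr2 !rmorphM /= !horner_mx_X !horner_mx_C.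
by rewrite -[c%:M * A]/(c%:M *m A) mul_scalar_mx.
Qed.

Section SpectralGap.

Variables (F : rcfType) (n : nat) (b : bool) (l : seq bool) (o : sqpair n.+1) (s : 'S_n.+1).
Hypotheses (prim : primitive_origami o) (los : moves (b :: l) o = conj_pair o s).
Hypotheses (tl : true \in l) (fl : false \in l).

Local Notation M R := (slopes_mx R (b :: l)).
Local Notation Phi R := (transport R (b :: l) o s).
Local Notation N := (n + n.+1)%N.

Lemma slopes_mx_entries :
  [/\ 1 <= M int 0 0, 1 <= M int 1 1, 1 <= M int 0 1, 1 <= M int 1 0 & \det (M int) = 1].
Proof.
have [[m00 m11] _ m01 m10 d1] := slopes_mx_pos (b :: l).
by split=> //; [apply: m01 | apply: m10]; rewrite inE ?tl ?fl orbT.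
Qed.

(** Let lam > 1 be the dominant eigenvalue of M and mu = 1/lam the other one.
    Over F, the vector G1 = g (Phi - mu) satisfies G1 Phi = lam G1 modulo
    coboundaries.  As Phi acts on potentials by a permutation, of which lam is not an
    eigenvalue, G1 can be corrected by a coboundary into a true eigenvector, which
    is zero by [perron].  Hence g Phi = mu g modulo coboundaries; but g and Phi are
    rational and mu is not, so g is a coboundary. *)
Lemma char_poly_coboundary (g : 'rV[rat]_(n.+1 + n.+1)) : csum g = 0 ->
  (g *m horner_mx (Phi rat : 'M_N.+1) (char_poly (M rat)) <= coboundary_mx rat o)%MS ->
  (g <= coboundary_mx rat o)%MS.
Proof.
move=> g0 gW; have [m00 m11 m01 m10 d1] := slopes_mx_entries.
have [lam [y [lam1 y0 yE lamE]]] := dominant_eigenvector F m00 m11 m01 m10 d1.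
set t := \tr (M int) in lamE.
have lam0 : 0 < lam by exact: lt_trans lam1.
pose q : {rmorphism rat -> F} := ratr.
have qint m : q m%:~R = m%:~R := rmorph_int q m.
pose G : 'rV[F]_(n.+1 + n.+1) := map_mx q g.
have PhiE : map_mx q (Phi rat) = Phi F by exact: map_transport.
have MintE (K : comNzRingType) : map_mx (intr : int -> K) (M int) = M K by exact: map_slopes.
pose mu := t%:~R - lam.
have lamu : lam * mu = 1.
  apply/eqP; rewrite -subr_eq0; apply/eqP.
  by rewrite -[RHS]oppr0 -lamE /mu; ring.
have trE : \tr (M rat) = t%:~R by rewrite -MintE /t !tr_mx22 !mxE rmorphD.
have detE : \det (M rat) = 1 by rewrite -MintE det_map_mx d1 rmorph1.
have [u uE] : exists u : 'rV[F]_n.+1,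
    G *m Phi F *m Phi F - t%:~R *: (G *m Phi F) + G = u *m coboundary_mx F o.
  have [w wE] := submxP gW; exists (map_mx q w).
  rewrite -(map_coboundary q) -map_mxM -wE char_poly22 trE detE.
  rewrite horner_mx_quadratic mulmxDr mulmxBr mulmx1 -scalemxAr.
  move: (Phi rat) PhiE => P PE.
  by rewrite map_mxD map_mxB map_mxZ !map_mxM qint PE -[in LHS]mulmxA.
pose G1 := G *m Phi F - mu *: G.
have G1E : G1 *m Phi F = lam *: G1 + u *m coboundary_mx F o.
  rewrite -uE /G1 mulmxBl -scalemxAl.
  have -> : t%:~R = mu + lam by rewrite /mu subrK.
  move: (G *m Phi F *m Phi F) (G *m Phi F) => x z.
  rewrite scalerBr scalerA lamu scale1r; apply/rowP=> j; rewrite !mxE; ring.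
have unitB := perm_scalar_unit (s^-1)%g lam1.
have [v vE] : exists v, lam *: v - v *m perm_mx (s^-1)%g = u.
  by exists (u *m invmx (lam%:M - perm_mx (s^-1)%g)); rewrite -mul_mx_scalar -mulmxBr mulmxKV.
have G2 : G1 + v *m coboundary_mx F o = 0.
  apply: (perron prim los tl fl lam0 y0); first by rewrite -MintE.
    rewrite mulmxDl G1E -mulmxA (coboundary_transport _ los) mulmxA -vE.
    by rewrite mulmxBl [RHS]scalerDr -scalemxAl -addrA subrK.
  have G0 : csum G = 0 by rewrite map_csum g0 map_mx0.
  rewrite csumD csum_coboundary addr0 /G1 -scaleN1r scalerA csumD csumZ G0 scaler0 addr0.
  by rewrite csum_transport G0 mul0mx.
have dep : map_mx q (g *m Phi rat *m cokermx (coboundary_mx rat o)) =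
    mu *: map_mx q (g *m cokermx (coboundary_mx rat o)).
  have GE : G *m Phi F - mu *: G = - (v *m coboundary_mx F o).
    by apply/eqP; rewrite -addr_eq0; apply/eqP.
  have CE : coboundary_mx F o *m map_mx q (cokermx (coboundary_mx rat o)) = 0.
    by rewrite map_cokermx map_coboundary mulmx_coker.
  move: (Phi rat) (Phi F) (cokermx _) PhiE GE CE => P P' C PE GE CE.
  rewrite !map_mxM PE -/G scalemxAl.
  by apply/eqP; rewrite -subr_eq0 -mulmxBl GE mulNmx -mulmxA CE mulmx0 oppr0.
rewrite submxE; apply: contraT => /eqP gC.
have [j gj] : exists j, (g *m cokermx (coboundary_mx rat o)) 0 j != 0.
  apply/existsP; apply: contraT => /existsPn gC0; case: gC; apply/rowP=> j.
  by have := gC0 j; rewrite negbK [RHS]mxE => /eqP.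
have [k kE] : exists k, q k = mu.
  exists ((g *m Phi rat *m cokermx (coboundary_mx rat o)) 0 j /
          (g *m cokermx (coboundary_mx rat o)) 0 j).
  rewrite fmorph_div; apply/(canLR (mulfK _)); first by rewrite fmorph_eq0.
  have := congr1 (fun x : 'rV[F]_(n.+1 + n.+1) => x 0 j) dep.
  by rewrite [LHS]mxE [RHS]mxE [in RHS]mxE.
have kpoly : k ^+ 2 - t%:~R * k + 1 = 0.
  apply: (fmorph_inj q); rewrite rmorph0 rmorphD rmorphB rmorphXn rmorphM rmorph1 kE qint.
  have -> : mu ^+ 2 - t%:~R * mu + 1 = 1 - lam * mu by rewrite /mu; ring.
  by rewrite lamu subrr.
have /intrP[m km] : k \is a Num.int.
  apply: (@char_poly_rational_root 1 (M int)).
  rewrite MintE char_poly22 trE detE /root !(hornerD, hornerN, hornerM, hornerX, hornerC, hornerXn).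
  exact/eqP.
have : m ^+ 2 - t * m + 1 = 0.
  by apply: (@intr_inj rat); rewrite intrD intrB expr2 !intrM -km -expr2 kpoly.
rewrite /t tr_mx22; move: d1; rewrite det_mx22.
move: (M int 0 0) (M int 0 1) (M int 1 0) (M int 1 1) m00 m11 m01 m10 => A B C D A1 D1 B1 C1 d1 mE.
exfalso.
have t3 : 3 <= A + D.
  have BC : 1 <= B * C by nia.
  by have [A2|A2] : A = 1 \/ 2 <= A; [lia | rewrite A2 in d1 *; lia | lia].
(* The roots of X^2 - t X + 1 are integers only when they are 1 or -1, but t >= 3. *)
have : m * (A + D - m) = 1 by rewrite -[RHS]subr0 -mE; ring.
move=> mm; have : m \is a GRing.unit by apply/unitrPr; exists (A + D - m).
by rewrite qualifE /= => /orP[] /eqP mE1; rewrite mE1 in mm; lia.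
Qed.
End SpectralGap.

(** * Bounding the number of squares of a fixed origami *)

Lemma csum_const (R : comNzRingType) n (x : 'rV[R]_2) : csum (const_cochain n x) = n%:R *: x.
Proof.
apply: row2P; rewrite ?csum0 ?csum1 mxE.
  by under eq_bigr do rewrite hval_const; rewrite sumr_const card_ord mulr_natl.
by under eq_bigr do rewrite vval_const; rewrite sumr_const card_ord mulr_natl.
Qed.

Lemma cocycle_const (R : comNzRingType) n (o : sqpair n) (x : 'rV[R]_2) :
  cocycle o (const_cochain n x).
Proof. by move=> i _; rewrite cornerE !cochainE; ring. Qed.

Section Bound.

Variables (F : rcfType) (b : bool) (l : seq bool).
Hypotheses (tl : true \in l) (fl : false \in l).

Local Notation M R := (slopes_mx R (b :: l)).

Section Transport.

Variables (n : nat) (o : sqpair n.+1) (s : 'S_n.+1).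

Local Notation N := (n + n.+1)%N.
Local Notation Phi R := (transport R (b :: l) o s : 'M[R]_N.+1).

Lemma csum_horner (R : comNzRingType) (f : 'rV[R]_(n.+1 + n.+1)) (p : {poly R}) :
  @csum R n.+1 (f *m horner_mx (Phi R) p) = csum f *m horner_mx (M R) p.
Proof.
elim/poly_ind: p f => [|p c IHp] f.
  by rewrite !rmorph0 !mulmx0 -[0 in LHS](scale0r 0) csumZ scale0r.
rewrite !rmorphD !rmorphM /= !horner_mx_X !horner_mx_C !mulmxDr csumD !mul_mx_scalar csumZ.
rewrite -![_ * _]/(_ *m _) mulmxA [RHS]addrC [LHS]addrC; congr (_ + _).
by rewrite csum_transport IHp -mulmxA.
Qed.

Lemma const_horner (R : comNzRingType) (x : 'rV[R]_2) (p : {poly R}) :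
  const_cochain n.+1 x *m horner_mx (Phi R) p = const_cochain n.+1 (x *m horner_mx (M R) p).
Proof.
have cD (z w : 'rV[R]_2) : const_cochain n.+1 (z + w) = const_cochain n.+1 z + const_cochain n.+1 w.
  by apply: cochainP => i; rewrite !cochainE mxE.
have cZ a (z : 'rV[R]_2) : const_cochain n.+1 (a *: z) = a *: const_cochain n.+1 z.
  by apply: cochainP => i; rewrite !cochainE mxE.
elim/poly_ind: p x => [|p c IHp] x.
  by rewrite !rmorph0 !mulmx0 -[0 in RHS](scale0r 0) cZ scale0r.
rewrite !rmorphD !rmorphM /= !horner_mx_X !horner_mx_C !mulmxDr cD !mul_mx_scalar cZ.
rewrite -![_ * _]/(_ *m _) mulmxA IHp [RHS]addrC [LHS]addrC; congr (_ + _).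
by apply: (etrans (const_transport (b :: l) o s _)); rewrite -mulmxA.
Qed.

End Transport.

(** The bound is the largest possible size of the entries of e1 Q(M), where Q is the
    minimal polynomial of f0 modulo coboundaries. *)
Lemma fixed_origami_bound (c : nat) : exists B : nat, forall n (o : sqpair n.+1) s,
  primitive_origami o -> [~ o.1, o.2]%g != 1%g -> (#|[set i | ~~ regular o i]| <= c)%N ->
  moves (b :: l) o = conj_pair o s -> (n.+1 <= B)%N.
Proof.
pose e1 : 'rV[int]_2 := delta_mx 0 1.
pose K : int := (1 + (2 ^ size (b :: l))%:Z) ^+ (c + 2).
pose entry (j : 'I_2) (k : nat) := (e1 *m M int ^+ k) 0 j.
exists (\sum_(j < 2) \sum_(k < (c + 2).+1) absz (K * entry j k)%R)%N => n o s prim ncomm creg los.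
pose P (R : comNzRingType) : 'M[R]_((n + n.+1).+1) := transport R (b :: l) o s.
have PE : toQ (P int) = P rat := @map_transport _ _ (intr : {rmorphism int -> rat}) n.+1 (b :: l) o s.
have [f fc ftot] := exists_unit_cochain prim ncomm (ltn0Sn n).
pose f0 : 'rV[int]_(n.+1 + n.+1) := n.+1%:R *: f - const_cochain n.+1 e1.
have f0c : cocycle o (toQ f0).
  move=> i ri; rewrite -(map_corner (intr : {rmorphism int -> rat})) -map_mxM mxE.
  rewrite mulmxBl -scalemxAl mxE [X in X + _]mxE [X in _ + X]mxE fc // (cocycle_const e1) //.
  by rewrite mulr0 subr0 rmorph0.
have f0t : csum f0 = 0.
  by rewrite /f0 -scaleN1r csumD !csumZ ftot csum_const scaleN1r subrr.
have [|||||Q [Qm Qs Qc QW Qmin]] := @bounded_integral_annihilator (n + n.+1)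
    (c + 2) _ _ (2 ^ size (b :: l)) (P int) f0 (coboundary_mx rat o) (cocycle_mx o rat)
    (coboundary_cocycle _ _).
- by rewrite PE; apply/submxP; exists (perm_mx (s^-1)%g); apply: coboundary_transport.
- rewrite PE; apply/row_subP=> k; rewrite row_mul.
  exact/cocycle_mxP/(cocycle_transport los)/cocycle_mxP/row_sub.
- exact/cocycle_mxP.
- by apply: leq_trans (rank_cocycle_coboundary prim _) _; rewrite leq_add2l leq_add2r.
- move=> x; have -> : map_mx (intr : int -> algC) (P int) = P algC :=
    @map_transport _ _ (intr : {rmorphism int -> algC}) n.+1 (b :: l) o s.
  exact: (@sum_norm_transport algC n.+1 (b :: l) o s x).
pose ab : 'rV[int]_2 := e1 *m horner_mx (M int) Q.
have ab_le j : (absz (ab 0%R j) <= \sum_(k < (c + 2).+1) absz (K * entry j k)%R)%N.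
  rewrite /ab (horner_mx_sum _ Qs) mulmx_sumr summxE.
  apply: (big_ind2 (fun (x : int) (m : nat) => absz x <= m)%N) => // [x m y k|k _]; first by lia.
  rewrite -scalemxAr mxE !abszM leq_mul2r; apply/orP; right.
  by rewrite -lez_nat !abszE; apply: le_trans (Qc k) _; rewrite ler_norm.
have [w wE] := submxP QW.
have fQE : f0 *m horner_mx (P int) Q =
    n.+1%:R *: (f *m horner_mx (P int) Q) - const_cochain n.+1 ab.
  by rewrite /f0 mulmxBl -scalemxAl; congr (_ - _); apply: const_horner.
have {}wE : toQ (f0 *m horner_mx (P int) Q) = w *m coboundary_mx rat o.
  by rewrite -wE map_mxM map_horner_mx.
have n0 : n.+1%:R != 0 :> rat by rewrite pnatr_eq0.
have n0p : 1 + n%:R != 0 :> rat by rewrite addrC natr1.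
have div_ab j : (n.+1 %| absz (ab 0%R j))%N.
  (* n f Q(Phi) = ab + (coboundary of w), and f Q(Phi) is integral. *)
  pose u i := w 0 i / n.+1%:R.
  pose a j := - ((ab 0 j)%:~R / n.+1%:R) : rat.
  have [||a0 a1] := @potential_integral _ o prim ncomm u (a 0) (a 1) (ltn0Sn n).
  - move=> i; have := congr1 (fun x : 'rV_(n.+1 + n.+1) => hval x i) wE.
    rewrite hval_coboundary fQE /hval mxE -/(hval _ i) [hval _ i]hvalD hvalN hvalZ hval_const.
    rewrite rmorphB rmorphM /= => E; apply/intrP.
    exists (hval (f *m horner_mx (P int) Q : 'rV_(n.+1 + n.+1)) i).
    by rewrite /a /u -mulrBl -E rmorph_nat; field; exact: n0p. rewrite -natr1 addrC in n0.
  - move=> i; have := congr1 (fun x : 'rV_(n.+1 + n.+1) => vval x i) wE.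
    rewrite vval_coboundary fQE /vval mxE -/(vval _ i) [vval _ i]vvalD vvalN vvalZ vval_const.
    rewrite rmorphB rmorphM /= => E; apply/intrP.
    exists (vval (f *m horner_mx (P int) Q : 'rV_(n.+1 + n.+1)) i).
    by rewrite /a /u -mulrBl -E rmorph_nat; field; exact: n0p.
  have /intrP[m /(canRL (@opprK _))] : a j \is a Num.int.
    by case: j => [[|[|//]]] p; [move: a0 | move: a1]; congr (a _ \is a _); apply/val_inj.
  move/(canRL (mulfVK n0)) => E; apply/dvdnP; exists `|m|%N.
  have : ab 0 j = - m * n.+1 by apply: (@intr_inj rat); rewrite E intrM intrN.
  by move=> ->; rewrite abszM abszN.
have [j abj] : exists j, ab 0 j != 0.
  apply/existsP; apply: contraT => /existsPn ab0.
  have {}ab0 : ab = 0.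
    by apply/rowP=> j; have := ab0 j; rewrite negbK [RHS]mxE => /eqP.
  have [m00 m11 m01 m10 _] := slopes_mx_entries b tl fl.
  have ME : toQ (M int) = M rat := map_slopes (intr : {rmorphism int -> rat}) _.
  pose q := map_poly (intr : int -> rat) Q; pose chi := char_poly (M rat).
  have schi : size chi = 3%N by rewrite size_char_poly.
  have chi0 : chi != 0 by rewrite -size_poly_eq0 schi.
  have qM : toQ e1 *m horner_mx (M rat) q = 0.
    by rewrite -ME -map_horner_mx -map_mxM -/ab ab0 map_mx0.
  have sr : (size (q %% chi)%R <= 2)%N by rewrite -ltnS -schi ltn_modp.
  (* e1 and e1 M are independent, as the entry M 1 0 is positive. *)
  have r0 : q %% chi = 0.
    have qr : horner_mx (M rat) q = horner_mx (M rat) (q %% chi).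
      by rewrite {1}(divp_eq q chi) rmorphD rmorphM /= Cayley_Hamilton mulr0 add0r.
    move: qM; rewrite qr (horner_mx_sum _ sr) !big_ord_recl big_ord0 addr0 expr0 expr1 lift01.
    move: (_ %% _) sr => r sr; rewrite -ME => /rowP E.
    have e10 : toQ e1 0 0 = 0 by rewrite !mxE.
    have e11 : toQ e1 0 1 = 1 by rewrite !mxE.
    have {}E j : r`_0 * (1 == j)%:R + r`_1 * (M int 1 j)%:~R = 0.
      by have := E j; rewrite mul_mx22 e10 e11 mul0r mul1r add0r /= !mxE.
    have r1 : r`_1 = 0.
      have := E 0; rewrite mulr0 add0r => /eqP; rewrite mulf_eq0 intr_eq0.
      by rewrite [M int 1 0 == 0]gt_eqF ?orbF ?(lt_le_trans _ m10) // => /eqP.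
    have r0 : r`_0 = 0 by have := E 1; rewrite r1 mul0r addr0 mulr1.
    apply/polyP=> k; rewrite coef0; case: k => [|[|k]] //.
    by rewrite nth_default // (leq_trans sr).
  have chidvd : q = (q %/ chi) * chi by rewrite {1}(divp_eq q chi) r0 addr0.
  have q0 : q != 0 by rewrite map_poly_eq0_id0 ?monic_neq0 // (monicP Qm) oner_eq0.
  have R0 : q %/ chi != 0 by apply: contra q0 => /eqP E; rewrite chidvd E mul0r.
  have sR : (size (q %/ chi)%R < size Q)%N.
    have -> : size Q = size q by rewrite size_map_inj_poly //; exact: intr_inj.
    by rewrite [in X in (_ < X)%N]chidvd size_mul // schi !addnS addn0 ltnS leqnSn.
  case/negP: (Qmin _ R0 sR); rewrite PE.
  apply: (char_poly_coboundary F prim los tl fl).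
    by rewrite csum_horner map_csum f0t map_mx0 mul0mx.
  rewrite -mulmxA -[_ *m horner_mx _ chi]/(horner_mx _ _ * _) -rmorphM /= -chidvd -PE.
  exact: QW.
apply: leq_trans (dvdn_leq _ (div_ab j)) _; first by rewrite absz_gt0.
by rewrite (leq_trans (ab_le j)) // (bigD1 j) //= leq_addr.
Qed.

End Bound.

Lemma moves_conj n l (o : sqpair n) s : moves l (conj_pair o s) = conj_pair (moves l o) s.
Proof.
elim: l o => [|b l IHl] o //=; rewrite -IHl; congr moves.
by case: b; rewrite /move /conj_pair /= conjMg.
Qed.

(** The square of a word containing both letters contains both of them after its
    first letter. *)
Lemma no_fixed_origami (F : rcfType) (l : seq bool) (c : nat) : true \in l -> false \in l ->
  exists B : nat, forall n (o : sqpair n) s, primitive_origami o -> [~ o.1, o.2]%g != 1%g ->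
    (#|[set i | ~~ regular o i]| <= c)%N -> (B < n)%N -> moves l o <> conj_pair o s.
Proof.
case: l => // b l tl fl.
have [|| B BP] := @fixed_origami_bound F b (l ++ b :: l) _ _ c; try by rewrite mem_cat ?tl ?fl orbT.
exists B => -[|n] o s prim ncomm creg Bn los //.
suff /(BP n o (s * s)%g prim ncomm creg) : moves (b :: l ++ b :: l) o = conj_pair o (s * s)%g.
  by rewrite leqNgt Bn.
rewrite -cat_cons /moves foldl_cat -!/(moves _ _) los moves_conj los.
by rewrite /conj_pair /= !conjgM.
Qed.

(** * Origamis with a single zero *)

(** The only nontrivial cycle of the commutator has length k + 1, and the squares
    with a singular corner inject into it through i |-> h (v i). *)
Lemma minimal_stratum (k n : nat) (o : sqpair n) : in_stratum [:: k] o ->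
  [~ o.1, o.2]%g != 1%g /\ (#|[set i | ~~ regular o i]| <= k.+1)%N.
Proof.
set c := [~ o.1, o.2]%g; move=> st.
have zE : zero_orders o = [:: k] by apply: perm_small_eq.
pose S : seq {set 'I_n} := [seq C : {set 'I_n} <- enum (porbits c) | (0 < #|C|.-1)%N].
have SE : [seq #|C|.-1 | C : {set 'I_n} <- S] = [:: k] by rewrite -zE /zero_orders filter_map.
have [C0 S0] : exists C0, S = [:: C0].
  by case: S SE => [|C [|C' S]] //= _; exists C.
have C0k : #|C0|.-1 = k by move: SE; rewrite S0 => -[].
have : C0 \in S by rewrite S0 mem_head.
rewrite mem_filter => /andP[C01]; rewrite mem_enum => /imsetP[x0 _ C0E].
have moved x : c x != x -> x \in C0.
  move=> cx; suff : porbit c x \in S by rewrite S0 inE => /eqP <-; apply: porbit_id.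
  rewrite mem_filter mem_enum imset_f // andbT -ltnS prednK; last first.
    by apply/card_gt0P; exists x; apply: porbit_id.
  apply: leq_trans (_ : #|[set x; c x]| <= _)%N; first by rewrite cards2 [x == _]eq_sym cx.
  apply/subset_leq_card/subsetP=> y /set2P[] ->.   by rewrite porbit_id.
  by have := mem_porbit c 1 x; rewrite expg1.
split.
  apply: contraTneq C01 => c1; rewrite C0E c1.
  suff -> : porbit 1 x0 = [set x0] by rewrite cards1.
  apply/setP=> y; rewrite inE; apply/porbitP/eqP => [[i ->]|->]; first by rewrite expg1n perm1.
  by exists 0; rewrite expg0 perm1.
have : (#|C0| <= k.+1)%N by rewrite -C0k leqSpred.
apply: leq_trans; rewrite -[X in (X <= _)%N](card_imset _ (@perm_inj _ (o.2 * o.1)%g)).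
apply/subset_leq_card/subsetP=> x /imsetP[i]; rewrite inE => ri ->.
apply: moved; apply: contra ri => /eqP; rewrite /c commgEl conjgE !permM !permK => E.
by rewrite /regular E.
Qed.

(** * Fixed points of short words in actions of the braid group *)

Fixpoint words_upto (T : Type) (A : seq T) (k : nat) : seq (seq T) :=
  if k is k'.+1 then [::] :: [seq x :: w | x <- A, w <- words_upto A k'] else [:: [::]].

Lemma mem_words_upto (T : eqType) (A : seq T) (k : nat) (w : seq T) :
  (forall x, x \in A) -> (size w <= k)%N -> w \in words_upto A k.
Proof.
move=> allA; elim: k w => [|k IHk] [|x w] // sw; rewrite -[words_upto _ _]/(_ :: _) in_cons.
by apply/orP; right; apply: (allpairs_f (fun x w => x :: w)); [apply: allA | apply: IHk].
Qed.

(** The letter (g, i) is the generator T (if g) or S, inverted if i. *)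
Notation letter := (bool * bool)%type.
Definition letter_inv (x : letter) : letter := (x.1, ~~ x.2).
(** Conjugation by the half twist aba of the braid group: it exchanges a = T and
    b = S^-1. *)
Definition letter_swap (x : letter) : letter := (~~ x.1, ~~ x.2).
Definition word_inv (w : seq letter) : seq letter := rev (map letter_inv w).
Definition cyclically_reduced (w : seq letter) : bool :=
  path.cycle (fun x y : letter => y != letter_inv x) w.

Section BraidAction.

Variables (gT : finGroupType) (T : finType) (to : {action gT &-> T}) (G : {group gT}) (O : {set T}).
Variables (a b : gT).
Hypotheses (aG : a \in G) (bG : b \in G) (actsO : [acts G, on O | to]).
Hypothesis braid : (a * b * a = b * a * b)%g.

Definition fixed_in (g : gT) : {set T} := [set x in O | to x g == x].

Lemma fixed_in_conj g h : h \in G -> #|fixed_in (g ^ h)%g| = #|fixed_in g|.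
Proof.
move=> hG; rewrite -(card_imset (mem (fixed_in g)) (act_inj to h)); apply: eq_card => x.
apply/idP/imsetP => [|[y yg ->]]; rewrite !inE.
  case/andP=> xO /eqP xE; exists (to x h^-1%g); last by rewrite actKV.
  rewrite inE (acts_act actsO) ?groupV // xO /= -(inj_eq (act_inj to h)) actKV -!actM.
  by rewrite -conjgE xE.
move: yg; rewrite !inE (acts_act actsO) // => /andP[-> /eqP yE] /=.
by rewrite -actM conjgE mulKVg actM yE.
Qed.

Lemma fixed_in_inv g : fixed_in (g^-1)%g = fixed_in g.
Proof.
apply/setP=> x; rewrite !inE; congr (_ && _).
by rewrite -(inj_eq (act_inj to g)) actKV eq_sym.
Qed.

(** The images of the fixed points of g under 1, h, ..., h^(m-1) are pairwise
    disjoint. *)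
Lemma fixed_in_thin m g h : g \in G -> h \in G ->
  (forall d, (0 < d < m)%N -> fixed_in (g^-1 * g ^ (h ^+ d))%g = set0) ->
  (m * #|fixed_in g| <= #|O|)%N.
Proof.
move=> gG hG nofix.
have -> : (m * #|fixed_in g|)%N = #|setX [set: 'I_m] (fixed_in g)|.
  by rewrite cardsX cardsT card_ord.
pose phi (p : 'I_m * T) := to p.2 (h ^+ p.1)%g.
have hk k : (h ^+ k)%g \in G by rewrite groupX.
have key (i j : 'I_m) x y : (i < j)%N -> x \in fixed_in g -> y \in fixed_in g ->
    to x (h ^+ i)%g = to y (h ^+ j)%g -> False.
  move=> ij xg yg xy.
  have xE : x = to y (h ^+ (j - i))%g.
    by apply: (act_inj to (h ^+ i)%g); rewrite xy -actM -expgD subnK // ltnW.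
  have : x \in fixed_in (g^-1 * g ^ (h ^+ (j - i)))%g; last first.
    by rewrite nofix ?inE // subn_gt0 ij (leq_ltn_trans (leq_subr _ _)) /=.
  move: xg yg; rewrite !inE => /andP[xO /eqP gx] /andP[yO /eqP gy].
  rewrite xO actM -{1}gx actK; apply/eqP.
  by rewrite {1}xE -actM conjgE mulKVg actM gy -xE.
rewrite -(card_in_imset (f := phi)).
  apply/subset_leq_card/subsetP=> _ /imsetP[[i x] /= /setXP[_ xg] ->].
  by move: xg; rewrite inE (acts_act actsO) // => /andP[].
move=> [i x] [j y] /setXP[/= _ xg] /setXP[/= _ yg]; rewrite /phi /= => E.
case: (ltngtP i j) => [ij|ji|ij]; first by case: (key i j x y).
  by case: (key j i y x).
by rewrite (val_inj ij) in E *; rewrite (act_inj to _ E).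
Qed.

(** The letters are those of [move]: the inverse of T, and the inverse b of S. *)
Definition posw (l : seq bool) : gT := (\prod_(t <- l) (if t then a^-1 else b))%g.

Lemma posw_cat l l' : posw (l ++ l') = (posw l * posw l')%g.
Proof. exact: big_cat. Qed.

Lemma posw_cons t l : posw (t :: l) = ((if t then a^-1 else b) * posw l)%g.
Proof. exact: big_cons. Qed.

Lemma posw_true k : posw (nseq k true) = (a ^- k)%g.
Proof.
rewrite -expgVn; elim: k => [|k IHk] /=; first by rewrite /posw big_nil.
by rewrite posw_cons IHk expgS.
Qed.

Lemma posw_false k : posw (nseq k false) = (b ^+ k)%g.
Proof.
elim: k => [|k IHk] /=; first by rewrite /posw big_nil.
by rewrite posw_cons IHk expgS.
Qed.

Variable m : nat.
Hypothesis nofix : forall l, (size l <= 2 * m + 8)%N -> true \in l -> false \in l ->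
  fixed_in (posw l) = set0.

(** If g conjugates b to a, then g^-1 g^(b^d) = (b^-d)^g b^d = a^-d b^d. *)
Lemma thin_conjugator g : g \in G -> (b ^ g = a)%g -> (m * #|fixed_in g| <= #|O|)%N.
Proof.
move=> gG bg; apply: fixed_in_thin gG bG _ => d /andP[d0 dm].
have -> : (g^-1 * g ^ (b ^+ d) = posw (nseq d true ++ nseq d false))%g.
  rewrite posw_cat posw_true posw_false conjgE !mulgA; congr (_ * _)%g.
  by rewrite -!mulgA -conjgE conjVg conjXg bg.
apply: nofix; first by rewrite size_cat !size_nseq; lia.
  by rewrite mem_cat mem_nseq d0 eqxx.
by rewrite mem_cat !mem_nseq d0 eqxx orbT.
Qed.

Let Delta := (a * b * a)%g.

Lemma braid_a : (a ^ Delta = b)%g.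
Proof. by rewrite conjgE /Delta; apply: (mulgI Delta); rewrite mulKVg /Delta {1}braid !mulgA. Qed.

Lemma braid_b : (b ^ Delta = a)%g.
Proof. by rewrite conjgE /Delta; apply: (mulgI Delta); rewrite mulKVg /Delta {2}braid !mulgA. Qed.

Lemma braid_ab : (b ^ (a * b) = a)%g.
Proof. by rewrite conjgE; apply: (mulgI (a * b)%g); rewrite mulKVg braid !mulgA. Qed.

(** The central factor cancels in g^-1 g^(b^d), and the braid relation rewrites
    a^-k b^-d a^k b^d as the positive word
    a^-(k-1) b a^-(d-1) b^(k-1) a^-1 b^(d-1). *)
Lemma thin_parabolic z k : z \in G -> commute z a -> commute z b -> (0 < k <= 4)%N ->
  (m * #|fixed_in (z * a ^+ k)%g| <= #|O|)%N.
Proof.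
move=> zG za zb k04; apply: fixed_in_thin bG _; first by rewrite groupM ?groupX.
move=> d /andP[d0 dm].
have -> : ((z * a ^+ k)^-1 * (z * a ^+ k) ^ (b ^+ d) =
   posw (nseq k.-1 true ++ false :: nseq d.-1 true ++
         nseq k.-1 false ++ true :: nseq d.-1 false))%g.
  rewrite conjMg [(z ^ _)%g]conjgE (commuteX d zb) mulKg invMg -mulgA mulKg.
  rewrite posw_cat posw_cons 2!posw_cat posw_cons !posw_true !posw_false.
  rewrite -(prednK d0) -(prednK (proj1 (andP k04))) /=.
  move: d.-1 k.-1 => j i; set X := (b ^- j * a ^+ i)%g.
  have XE : (X ^ Delta = a ^- j * b ^+ i)%g by rewrite conjMg conjVg !conjXg braid_a braid_b.
  rewrite [(a ^- j * (b ^+ i * _))%g]mulgA -XE [(X ^ _)%g]conjgE.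
  have bD : (b * Delta^-1 = a^-1 * b^-1)%g by rewrite /Delta braid !invMg !mulgA mulgV mul1g.
  have aS : (a ^- i.+1 = a ^- i * a^-1)%g by rewrite expgS invMg.
  have bS : (b ^- j.+1 = b^-1 * b ^- j)%g by rewrite expgSr invMg.
  rewrite -!mulgA mulKVg [(b * (Delta^-1 * _))%g]mulgA bD.
  by rewrite conjgE aS bS expgSr [(b ^+ j.+1)%g]expgS /X !mulgA.
apply: nofix; rewrite ?size_cat /= ?size_cat /= ?size_nseq;
  by rewrite ?mem_cat ?inE ?mem_cat ?inE ?eqxx ?orbT //; lia.
Qed.

Definition letter_val (x : letter) : gT :=
  if x.1 then (if x.2 then a^-1 else a)%g else (if x.2 then b else b^-1)%g.
Definition word_val (w : seq letter) : gT := (\prod_(x <- w) letter_val x)%g.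

Lemma word_val_cons x w : word_val (x :: w) = (letter_val x * word_val w)%g.
Proof. exact: big_cons. Qed.

Lemma word_val_cat w w' : word_val (w ++ w') = (word_val w * word_val w')%g.
Proof. exact: big_cat. Qed.

Lemma word_val_nil : word_val [::] = 1%g. Proof. exact: big_nil. Qed.

Lemma letter_valG x : letter_val x \in G.
Proof. by case: x => [[] []]; rewrite /letter_val /= ?groupV. Qed.

Lemma word_valG w : word_val w \in G.
Proof.
elim: w => [|x w IHw]; first by rewrite word_val_nil group1.
by rewrite word_val_cons groupM // letter_valG.
Qed.

Definition thin (w : seq letter) : bool := (m * #|fixed_in (word_val w)| <= #|O|)%N.

Lemma word_val_inv w : word_val (word_inv w) = (word_val w)^-1%g.
Proof.
elim: w => [|x w IHw]; first by rewrite word_val_nil invg1.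
rewrite /word_inv /= rev_cons -cats1 word_val_cat -/(word_inv w) IHw [in RHS]word_val_cons invMg.
rewrite word_val_cons word_val_nil mulg1; congr (_ * _)%g.
by case: x => [[] []]; rewrite /letter_val /= ?invgK.
Qed.

Lemma word_val_swap w : word_val (map letter_swap w) = (word_val w ^ Delta)%g.
Proof.
elim: w => [|x w IHw]; first by rewrite word_val_nil conj1g.
rewrite /= !word_val_cons IHw conjMg; congr (_ * _)%g.
by case: x => [[] []]; rewrite /letter_val /= ?conjVg ?braid_a ?braid_b.
Qed.

Lemma thin_inv w : thin (word_inv w) = thin w.
Proof. by rewrite /thin word_val_inv fixed_in_inv. Qed.

Lemma thin_swap w : thin (map letter_swap w) = thin w.
Proof. by rewrite /thin word_val_swap fixed_in_conj // !groupM. Qed.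

Lemma thin_rot k w : thin (seq.rot k w) = thin w.
Proof.
rewrite /thin /seq.rot -[in RHS](cat_take_drop k w) !word_val_cat.
have -> : (word_val (drop k w) * word_val (take k w) =
  (word_val (take k w) * word_val (drop k w)) ^ word_val (take k w))%g by rewrite conjgE -!mulgA mulKg.
by rewrite fixed_in_conj // word_valG.
Qed.

Local Notation la := (true, false).
Local Notation lA := (true, true).
Local Notation lb := (false, true).
Local Notation lB := (false, false).

(** Each of them has the form b^j (a b) a^k, hence conjugates b to a; most of them
    are elliptic, and (j, k) = (-1, -1) gives a commutator. *)
Definition elliptic_words : seq (seq letter) :=
  [:: [:: la; lb]; [:: la; lb; la]; [:: la; lb; la; la]; [:: lb; la; lb; la];
      [:: lb; la; lb; lA]; [:: lB; la; lb; la]; [:: lB; la; lb; lA]].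
(** The last one, b a a b, is the central element (aba)^2 times a^-2. *)
Definition parabolic_words : seq (seq letter) :=
  [:: [:: la]; [:: la; la]; [:: la; la; la]; [:: la; la; la; la]; [:: lb; la; la; lb]].
(** Words in the positive letters a^-1 and b. *)
Definition hyperbolic_words : seq (seq letter) :=
  [:: [:: lb; lA]; [:: lb; lA; lA]; [:: lb; lA; lA; lA]; [:: lb; lb; lA; lA]; [:: lb; lA; lb; lA]].

Lemma thin_elliptic w : w \in elliptic_words -> thin w.
Proof.
move=> wE; apply: thin_conjugator (word_valG w) _.
have fixJ (x : gT) : (x ^ x = x)%g /\ (x ^ x^-1 = x)%g.
  by rewrite !conjgE mulKg invgK mulgV mulg1.
have [[aa aA] [bb bB]] := (fixJ a, fixJ b).
have bab : ((b ^ a) ^ b = a)%g by rewrite -conjgM braid_ab.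
suff : all (fun w => b ^ word_val w == a)%g elliptic_words by move/allP/(_ w wE)/eqP.
by rewrite /= !word_val_cons word_val_nil /letter_val /= !mulg1 !conjgM !(aa, aA, bb, bB, bab) eqxx.
Qed.

Lemma thin_parabolic_words w : w \in parabolic_words -> thin w.
Proof.
have zE : commute (Delta ^+ 2)%g a /\ commute (Delta ^+ 2)%g b.
  (* The square of the half twist is central. *)
  have D2 (x : gT) : ((x ^ Delta) ^ Delta = x)%g -> commute (Delta ^+ 2)%g x.
    by move=> xE; rewrite /commute -{1}xE -conjgM expgS expg1 conjgE mulKVg.
  by split; apply: D2; rewrite ?braid_a ?braid_b ?braid_a.
have thin_pow z k u : z \in G -> commute z a -> commute z b -> (0 < k <= 4)%N ->
    word_val u = (z * a ^+ k)%g -> thin u.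
  by move=> zG za zb kk uE; rewrite /thin uE thin_parabolic.
have pow k u : (0 < k <= 4)%N -> word_val u = (a ^+ k)%g -> thin u.
  by move=> kk uE; apply: (thin_pow 1%g k) => //; rewrite ?mul1g //; apply/commute_sym/commute1.
rewrite !inE => /or4P[/eqP->|/eqP->|/eqP->|/orP[]/eqP->].
- by apply: (pow 1); rewrite // !word_val_cons word_val_nil !mulg1.
- by apply: (pow 2); rewrite // !word_val_cons word_val_nil !mulg1.
- by apply: (pow 3); rewrite // !word_val_cons word_val_nil !mulg1.
- by apply: (pow 4); rewrite // !word_val_cons word_val_nil !mulg1.
rewrite -thin_inv; apply: (thin_pow (Delta ^- 2)%g 2); rewrite ?word_val_inv //.
- by rewrite groupV groupX // !groupM.
- by apply/commute_sym/commuteV/commute_sym; case: zE.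
- by apply/commute_sym/commuteV/commute_sym; case: zE.
have -> : word_val [:: lb; la; la; lb] = (Delta ^+ 2 * a ^- 2)%g.
  apply: (canRL (mulgK _)); rewrite !word_val_cons word_val_nil /letter_val /= !expgS !expg0 !mulg1.
  have : (b * a * (a * b * a) * a = (b * a * b) * (a * b * a))%g by rewrite {1}braid !mulgA.
  by rewrite -braid => <-; rewrite !mulgA.
by rewrite invMg invgK; apply: (commuteV (commute_sym (commuteX 2 (proj1 zE)))).
Qed.

Lemma thin_hyperbolic w : w \in hyperbolic_words -> (0 < m)%N -> thin w.
Proof.
move=> wH m0; suff [l [ls lt lf lE]] : exists l,
    [/\ (size l <= 8)%N, true \in l, false \in l & word_val w = posw l].
  by rewrite /thin lE nofix ?cards0 ?muln0 // (leq_trans ls) ?leq_addl.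
exists (map fst w); move: wH; rewrite !inE => /or4P[|||/orP[]] /eqP ->; split;
  by rewrite /= ?inE // !word_val_cons word_val_nil !posw_cons /posw big_nil.
Qed.

Definition word_variants (w : seq letter) : seq (seq letter) :=
  [seq seq.rot k u | u <- [:: w; word_inv w; map letter_swap w; map letter_swap (word_inv w)],
                     k <- iota 0 4].

Lemma thin_variants w u : u \in word_variants w -> thin u = thin w.
Proof.
case/allpairsP=> -[v k] [/= vw _ ->]; rewrite thin_rot.
by move: vw; rewrite !inE => /or4P[] /eqP ->; rewrite ?thin_swap ?thin_inv.
Qed.

Definition all_letters : seq letter := [:: la; lA; lb; lB].

Lemma mem_all_letters x : x \in all_letters.
Proof. by case: x => [[] []]. Qed.

(** Cyclic rotations, inversion and the exchange of a and b reduce the cyclically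
    reduced words of length at most four to the three lists above. *)
Lemma short_word_variants :
  all (fun w => [|| w == [::], ~~ cyclically_reduced w |
    has (fun u => u \in elliptic_words ++ parabolic_words ++ hyperbolic_words) (word_variants w)])
  (words_upto all_letters 4).
Proof. by vm_compute. Qed.

Lemma thin_short_word w : (0 < m)%N -> (0 < size w <= 4)%N -> cyclically_reduced w -> thin w.
Proof.
move=> m0 /andP[w0 w4] wr.
have := allP short_word_variants w (mem_words_upto mem_all_letters w4).
case/or3P=> [/eqP w_nil||/hasP[u /thin_variants <-]]; [by rewrite w_nil in w0 | by rewrite wr |].
rewrite !mem_cat => /or3P[|| uh]; [exact: thin_elliptic | exact: thin_parabolic_words |].
exact: thin_hyperbolic.
Qed.

End BraidAction.

(** * From short faces to short words *)

Section ShortFaces.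

Variables (n : nat) (o : sqpair n) (rho : {perm dart (orbit_graph o)}).
Hypothesis rot : rotation_system rho.

Local Notation O := (SL2Z_orbit o).
Local Notation to := ('P^*)%act.
Local Notation G := (SL2Z_group n).
Local Notation dartO := (dart (orbit_graph o)).
Local Notation phi := (face_perm rho).
Local Notation tl d := (@Defs.tail (orbit_graph o) d).
Local Notation wv := (word_val (permT n) (permS n)^-1%g).

Definition dart_letter (d : dartO) : bool * bool := (d.1.2, d.2).

Definition dart_word (d : dartO) (k : nat) : seq (bool * bool) := map dart_letter (traject phi d k).

Lemma tail_rev (d : dartO) :
  val (tl (dart_rev d)) = to (val (tl d)) (letter_val (permT n) (permS n)^-1%g (dart_letter d)).
Proof.
case: d => [[X g] i]; have gE : gen n g @: val X = to (val X) (gen n g) by [].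
rewrite /Defs.tail /dart_rev /dart_letter /=; case: i => /=; rewrite gE /letter_val /=.
  by case: g {gE}; rewrite /gen ?invgK actK.
by case: g {gE}; rewrite /gen ?invgK.
Qed.

(** T and S act injectively, so an edge is determined by its label and either end. *)
Lemma dart_inj (d e : dartO) : tl d = tl e -> dart_letter d = dart_letter e -> d = e.
Proof.
case: d => [[X g] i]; case: e => [[Y k] j]; rewrite /Defs.tail /dart_letter /= => + [gk ij].
rewrite {}gk {}ij; case: j => /= [/(congr1 val)/= XY|-> //].
congr (_, _, _); apply: val_inj; apply: (imset_inj (@perm_inj _ (gen n k))); exact: XY.
Qed.

Lemma tail_face (d : dartO) : tl (phi d) = tl (dart_rev d).
Proof.
rewrite /face_perm permM permE; apply/eqP; rewrite -rot.
by have := mem_porbit rho 1 (dart_rev d); rewrite expg1.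
Qed.

Lemma tail_dart_word k (d : dartO) : val (tl (iter k phi d)) = to (val (tl d)) (wv (dart_word d k)).
Proof.
elim: k d => [|k IHk] d; first by rewrite /dart_word /= word_val_nil act1.
by rewrite iterSr IHk /dart_word /= word_val_cons actM tail_face tail_rev.
Qed.

(** Turning back would make the rotation fix a dart, but every vertex has at least
    two outgoing edges, one for T and one for S. *)
Lemma face_no_backtrack (d : dartO) : dart_letter (phi d) != letter_inv (dart_letter d).
Proof.
apply/negP=> /eqP E.
have pE : phi d = dart_rev d by apply: dart_inj; [exact: tail_face | rewrite E].
set e := dart_rev d in pE; have re : rho e = e by rewrite -[RHS]pE /face_perm permM permE.
(* A dart leaving the same vertex along the other generator. *)
pose e' : dartO := ((tl e, ~~ e.1.2), false).
have : e' \in porbit rho e by rewrite rot.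
case/porbitP=> k ek; have {ek}: e' = e.
  by rewrite ek; elim: k {ek} => [|k IHk]; rewrite ?expg0 ?perm1 // expgSr permM IHk.
by move/(congr1 (fun x : dartO => x.1.2)) => /= /esym; case: (e.1.2).
Qed.

Lemma dart_word_reduced k (d : dartO) : (0 < k)%N -> iter k phi d = d ->
  cyclically_reduced (dart_word d k).
Proof.
case: k => // k _ kd; rewrite /cyclically_reduced /dart_word /= -map_rcons path_map.
have -> : rcons (traject phi (phi d) k) d = traject phi (phi d) k.+1.
  by rewrite trajectSr -iterSr kd.
apply: sub_path (fpath_traject _ _ _) => x _ /eqP <-.
exact: face_no_backtrack.
Qed.

Local Notation words := (words_upto all_letters 4).

(** A dart on a short face is determined by the word read along the face from it,
    together with its tail, which that word fixes. *)
Lemma card_short_faces m :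
  (forall w, (0 < size w <= 4)%N -> cyclically_reduced w ->
     m * #|fixed_in to O (wv w)| <= #|O|)%N ->
  (m * #|short_faces rho| <= size words * #|O|)%N.
Proof.
move: (words_upto all_letters 4) (fun w => @mem_words_upto _ all_letters 4 w mem_all_letters).
move=> W memW thinP; pose short := [set d : dartO | #|porbit phi d| <= 4]%N.
pose word d := dart_word d #|porbit phi d|.
have sw d : size (word d) = #|porbit phi d| by rewrite size_map size_traject.
have pk d : (0 < #|porbit phi d|)%N by apply/card_gt0P; exists d; apply: porbit_id.
have closed_walk d : iter #|porbit phi d| phi d = d by exact: iter_porbit.
have faces_short : (#|short_faces rho| <= #|short|)%N.
  apply: leq_trans (leq_imset_card (porbit phi) (mem short)).
  apply/subset_leq_card/subsetP=> f; rewrite inE => /andP[/imsetP[d _ ->] fd].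
  by apply: imset_f; rewrite inE.
have short_words : (#|short| <= \sum_(w <- W) #|[set d in short | word d == w]|)%N.
  under eq_bigr => w _ do rewrite -sum1_card big_mkcond /=.
  rewrite exchange_big -sum1_card big_mkcond /=; apply: leq_sum => d _.
  case: ifP => // dS; rewrite (big_rem (word d)) /=; last first.
    by apply: memW; rewrite sw; move: dS; rewrite inE.
  by rewrite inE dS eqxx leq_addr.
have bound w : (m * #|[set d in short | word d == w]| <= #|O|)%N.
  have [->|[d0]] := set_0Vmem [set d in short | word d == w]; first by rewrite cards0 muln0.
  rewrite inE => /andP[d0S /eqP d0w].
  have w4 : (0 < size w <= 4)%N by rewrite -d0w sw pk; move: d0S; rewrite inE.
  have wr : cyclically_reduced w by rewrite -d0w; apply: dart_word_reduced.
  apply: leq_trans (thinP w w4 wr); rewrite leq_mul2l; apply/orP; right.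
  rewrite -(card_in_imset (f := fun d : dartO => val (tl d))).
    apply/subset_leq_card/subsetP=> _ /imsetP[d + ->]; rewrite !inE => /andP[_ /eqP <-].
    by rewrite (valP (tl d)) /= -tail_dart_word closed_walk.
  move=> d e; rewrite !inE => /andP[_ /eqP dw] /andP[_ /eqP ew] de.
  apply: dart_inj; first exact: val_inj.
  have := pk d; have := pk e; move: ew; rewrite -dw /word.
  case: #|porbit phi d| => // k; case: #|porbit phi e| => // k'.
  by rewrite /dart_word /= => /eqP; rewrite eqseq_cons => /andP[/eqP -> _].
apply: leq_trans (leq_mul (leqnn m) (leq_trans faces_short short_words)) _.
rewrite big_distrr /= -sum1_size big_distrl /=.
by apply: leq_sum => w _; rewrite mul1n bound.
Qed.

End ShortFaces.

(** * The braid relation on an orbit *)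

Section OrbitAction.

Variables (n : nat) (o : sqpair n).

Local Notation to := ('P^*)%act.
Local Notation G := (SL2Z_group n).
Local Notation a := (permT n).
Local Notation b := (permS n)^-1%g.

Lemma iso_class_refl (p : sqpair n) : p \in iso_class p.
Proof. by apply/imsetP; exists 1%g; rewrite ?inE // !conjg1; case: p. Qed.

Lemma iso_classP (p q : sqpair n) : p \in iso_class q -> exists s, p = conj_pair q s.
Proof. by case/imsetP=> s _ ->; exists s. Qed.

Lemma permT_move (p : sqpair n) : permT n (move true p) = p.
Proof. by rewrite permE /actT /= mulgK; case: p. Qed.

Lemma permS_move (p : sqpair n) : permS n (move false p) = p.
Proof. by rewrite permE /actS /= mulgK; case: p. Qed.

Lemma gen_iso_class g (p : sqpair n) : gen n g @: iso_class p = iso_class (gen n g p).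
Proof.
rewrite /iso_class -imset_comp; apply: eq_imset => s /=; rewrite /gen.
by case: g; rewrite !permE /actT /actS /= !conjMg !conjVg.
Qed.

Lemma iso_class_move (t : bool) (p : sqpair n) :
  to (iso_class p) (if t then a^-1 else b)%g = iso_class (move t p).
Proof.
have -> : (if t then a^-1 else b)%g = (gen n t)^-1%g by case: t.
apply: (canLR (actK to _)); rewrite -[RHS]/(gen n t @: iso_class (move t p)) gen_iso_class.
by congr iso_class; case: t; rewrite /gen ?permT_move ?permS_move.
Qed.

Lemma iso_class_moves l (p : sqpair n) : to (iso_class p) (posw a b l) = iso_class (moves l p).
Proof.
elim: l p => [|t l IHl] p; first by rewrite /posw big_nil act1.
by rewrite posw_cons actM iso_class_move IHl.
Qed.

(** Both sides map (h, v) to (h v h^-1, h^-1). *)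
Lemma braid_TS : (a * b * a = b * a * b)%g.
Proof.
have aE p : a p = (p.1, (p.2 * p.1^-1)%g) by rewrite permE.
have bE (p : sqpair n) : b p = ((p.1 * p.2)%g, p.2).
  by apply: (@perm_inj _ (permS n)); rewrite permKV; apply/esym/(permS_move p).
apply/permP=> p; rewrite !permM !(aE, bE) /=.
have cancel (h k : 'S_n) : (k * (h * k)^-1 = h^-1)%g by rewrite invMg mulKVg.
by rewrite !cancel mulgA.
Qed.

Lemma permT_SL2Z : a \in G. Proof. by rewrite mem_gen // !inE eqxx. Qed.
Lemma permSV_SL2Z : b \in G. Proof. by rewrite groupV mem_gen // !inE eqxx orbT. Qed.

Lemma orbit_iso_class X : X \in SL2Z_orbit o -> exists p, X = iso_class p.
Proof.
case/orbitP=> g gG <-; move: o.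
apply: (@gen_ind _ _ (fun g => forall p, exists q, to (iso_class p) g = iso_class q) _ _ g gG).
  by move=> p; exists p; rewrite act1.
move=> x y xTS IHy p; have [t ->] : exists t, x = gen n t.
  by case/set2P: xTS => ->; [exists true | exists false].
by rewrite actM [to _ (gen n t)](gen_iso_class t p).
Qed.

Lemma acts_orbit_SL2Z : [acts G, on SL2Z_orbit o | to].
Proof. by apply: acts_orbit; apply: subsetT. Qed.

End OrbitAction.

(** * Scarcity of short faces *)

(** One bound serves all words of bounded length, of which there are finitely many.
    The number 7 is the length of the commutator cycle at a zero of order 6. *)
Lemma no_fixed_class (F : rcfType) (K : nat) : exists N : nat,
  forall n (o : sqpair n), (N < n)%N ->
  (forall X, X \in SL2Z_orbit o -> forall p, p \in X -> primitive_origami p) ->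
  (forall X, X \in SL2Z_orbit o -> forall p, p \in X ->
     exists2 k, (k <= 6)%N & in_stratum [:: k] p) ->
  forall l, (size l <= K)%N -> true \in l -> false \in l ->
  fixed_in ('P^*)%act (SL2Z_orbit o) (posw (permT n) (permS n)^-1%g l) = set0.
Proof.
pose bad (l : seq bool) (B : nat) := forall n (o : sqpair n) s, primitive_origami o ->
  [~ o.1, o.2]%g != 1%g -> (#|[set i | ~~ regular o i]| <= 7)%N -> (B < n)%N ->
  moves l o <> conj_pair o s.
have [N NP] : exists N, forall l, l \in words_upto [:: true; false] K ->
    true \in l -> false \in l -> bad l N.
  elim: (words_upto _ _) => [|l W [N NP]]; first by exists 0%N.
  have [/andP[tl fl]|ntf] := boolP ((true \in l) && (false \in l)).
    have [B BP] := no_fixed_origami F 7 tl fl; exists (maxn B N) => l'.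
    rewrite in_cons => /orP[/eqP -> _ _ n o s po co ro Bn|lW tl' fl' n o s po co ro Bn].
      by apply: BP => //; apply: leq_ltn_trans Bn; apply: leq_maxl.
    by apply: (NP l') => //; apply: leq_ltn_trans Bn; apply: leq_maxr.
  exists N => l'; rewrite in_cons => /orP[/eqP -> tl fl|]; last exact: NP.
  by rewrite tl fl in ntf.
exists N => n o Nn prim strat l lK tl fl.
have lW : l \in words_upto [:: true; false] K by apply: mem_words_upto => // -[].
apply/eqP; rewrite -subset0; apply/subsetP=> X; rewrite !inE => /andP[XO /eqP Xfix].
have [p Xp] := orbit_iso_class XO; have pX : p \in X by rewrite Xp iso_class_refl.
have [k k6 /minimal_stratum[ncomm creg]] := strat X XO p pX.
move: Xfix; rewrite {1}Xp iso_class_moves => Xfix.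
have /iso_classP[s] : moves l p \in iso_class p by rewrite -Xp -Xfix iso_class_refl.
by move/(NP l lW tl fl n p s (prim X XO p pX) ncomm (leq_trans creg (k6 : (k.+1 <= 7)%N)) Nn).
Qed.

Theorem theorem1p3 (R : realType)
  (* the n for which the family has a member G_n, the orbit graph of o n *)
  (I : pred nat) (o : forall n : nat, sqpair n)
  (* every origami in the orbit is primitive *)
  (hprim : forall n, I n -> forall X, X \in SL2Z_orbit (o n) ->
     forall p, p \in X -> primitive_origami p)
  (hlocus : forall n, I n ->
     [\/ forall X, X \in SL2Z_orbit (o n) -> forall p, p \in X -> in_stratum [:: 2%N] p,
         forall X, X \in SL2Z_orbit (o n) -> forall p, p \in X -> Prym_locus R p [:: 4%N] 4
       | forall X, X \in SL2Z_orbit (o n) -> forall p, p \in X -> Prym_locus R p [:: 6%N] 2])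
  (rho : forall n : nat, {perm dart (orbit_graph (o n))})
  (hrho : forall n, I n -> min_genus_embedding (rho n))
  (eps : R) (heps : 0 < eps) :
  exists N : nat, forall n : nat, I n -> (N <= n)%N ->
    #|short_faces (rho n)|%:R <= eps * #|vert (orbit_graph (o n))|%:R.
Proof.
set C := size (words_upto all_letters 4).
have [m Cm] : exists m : nat, C%:R < eps * m%:R.
  exists (Num.truncn (C%:R / eps)).+1; rewrite mulrC -ltr_pdivrMr //.
  exact: truncnS_gt.
have m0 : (0 < m)%N.
  by rewrite lt0n; apply: contraTneq Cm => ->; rewrite mulr0 -leNgt ler0n.
have [N NP] := no_fixed_class R (2 * m + 8).
exists N.+1 => n In Nn.
have strat X : X \in SL2Z_orbit (o n) -> forall p, p \in X ->
    exists2 k, (k <= 6)%N & in_stratum [:: k] p.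
  move=> XO p pX; case: (hlocus n In) => [st|st|st].
  - by exists 2%N => //; apply: st pX.
  - by exists 4%N => //; have [] := st X XO p pX.
  - by exists 6%N => //; have [] := st X XO p pX.
have bound : (m * #|short_faces (rho n)| <= C * #|SL2Z_orbit (o n)|)%N.
  apply: (card_short_faces (proj1 (hrho n In))) => w.
  have nofix := NP n (o n) Nn (hprim n In) strat.
  exact: (thin_short_word (permT_SL2Z n) (permSV_SL2Z n) (acts_orbit_SL2Z (o n))
            (braid_TS n) nofix m0).
have -> : #|vert (orbit_graph (o n))| = #|SL2Z_orbit (o n)| by rewrite card_sig.
have mR : 0 < m%:R :> R by rewrite ltr0n.
rewrite -(ler_pM2l mR) -natrM; apply: le_trans (_ : (C * #|SL2Z_orbit (o n)|)%:R <= _).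
  by rewrite ler_nat.
by rewrite natrM mulrA ler_wpM2r ?ler0n // mulrC ltW // mulrC.
Qed.
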